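(* Let $\mathsf{StreamAlg}_0$ be a deterministic, polynomial-time streaming algorithm for Relaxed $k$-Sparse Recovery, and let $\mathsf{PFHE}$ be a $(\mathcal T,\epsilon)$-pseudorandom fully homomorphic encryption scheme with $(\mathcal T,\epsilon)$-security. Let the security parameter be $\lambda=\mathcal S(n)$ for some function $\mathcal S$. If for all $n\in\mathbb N$ the functions $\mathcal T,\epsilon,\mathcal S$ satisfy $\mathcal T(\mathcal S(n))=\Omega(\mathrm{poly}(n))$ and $\epsilon(\mathcal S(n))\le \mathrm{negl}(n)$ for some negligible function $\mathrm{negl}$, then the streaming algorithm $\mathsf{StreamAlg}$ described below is a white-box adversarially robust streaming algorithm for the $k$-Sparse Recovery problem.
   Context: Streaming model: $\vec x\in\mathbb{Z}^n$ starts at $0^n$ and receives $T\le\mathrm{poly}(n)$ updates $(i_t,\Delta_t)$ meaning $\vec x_{i_t}\leftarrow\vec x_{i_t}+\Delta_t$; entries of $\vec x$ always lie in $\{-N,\dots,N\}$, $N\in\mathrm{poly}(n)$. A streaming algorithm consists of Setup$(n)$, Update$(i_t,\Delta_t)$, Report$()$. $k$-Sparse Recovery: output $\vec x$ if $\|\vec x\|_0\le k$, else $\bot$. Relaxed $k$-Sparse Recovery: output $\vec x$ whenever $\|\vec x\|_0\le k$ (arbitrary output otherwise). White-box adversarial robustness (WAR): for every PPT (in $n$) adversary, in the game where the adversary sees the full internal state, parameters and all randomness used after setup and after every round, and adaptively chooses each update (and may query), the probability that some answered query is incorrect is $\mathrm{negl}(n)$. A function is negligible if it is eventually below $x^{-c}$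 for every $c>0$. FHE scheme: PPT algorithms Setup$(1^\lambda)\to(\mathsf{pk},\mathsf{sk})$, Enc$(\mathsf{pk},\mu\in\{0,1\})\to\mathsf{ct}$, Eval$(\mathsf{pk},C,\mathsf{ct}_1,\dots,\mathsf{ct}_\ell)\to\hat{\mathsf{ct}}$ for circuits $C:\{0,1\}^\ell\to\{0,1\}$ of depth $\le\mathrm{poly}(\lambda)$, Dec$(\mathsf{pk},\mathsf{sk},\hat{\mathsf{ct}})$; compact (evaluated ciphertexts have size $\le\mathrm{poly}(\lambda)$), correct (decryption of an evaluated ciphertext equals $C$ applied to the encrypted bits with probability 1). $(\mathcal T,\epsilon)$-security: there is $\lambda_0$ such that for $\lambda>\lambda_0$, every $\mathcal T(\lambda)$-time adversary given $(\mathsf{pk},\mathrm{Enc}(\mathsf{pk},b))$ for uniform bit $b$ guesses $b$ with advantage $2|1/2-\Pr[\text{correct}]|\le\epsilon(\lambda)$. Two distribution ensembles are $(\mathcal T,\epsilon)$-indistinguishable if for all $\lambda>\lambda_0$ every $\mathcal T(\lambda)$-time adversary distinguishes them with advantage at most $\epsilon(\lambda)$. $(\mathcal T,\epsilon)$-pseudorandom FHE: an FHE scheme such that (i) Eval is deterministic; (ii) there is an explicit distribution $\mathcal D_{\tilde{\mathsf{pk}}(\lambda)}$ that is $(\mathcal T,\epsilon)$-indistinguishable from the distribution of $\mathsf{pk}$ output by Setup; (iii) there is an explicit distribution $\mathcal D_{\tilde{\mathsf{ct}}(\lambda)}$ that is $(\mathcal T,\epsilon)$-indistinguishable from the distribution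 of $\mathrm{Enc}(\mathsf{pk},\mu)$ for $(\mathsf{pk},\mathsf{sk})\leftarrow$Setup, $\mu\in\{0,1\}$; (iv) ($\mathbb Z$ linear homomorphism) all ciphertexts lie in a vector space over $\mathbb Z_q$ for some $q=q(\lambda)$, and for any $\mathcal M=\sum_{i\in[k]}x_i\mathsf{ct}_i \bmod q$ with $x_i\in\mathbb Z$ and $k\cdot\max_i x_i\ll q$, where $\mu_i$ is the decryption of $\mathsf{ct}_i$, we have $|\mathcal M|\le\mathrm{poly}(\lambda)$ and a deterministic $\mathrm{poly}(\lambda)$-time algorithm LinearDec with $\mathrm{LinearDec}(\mathsf{pk},\mathsf{sk},\mathcal M)=\sum_i x_i\mu_i$ with probability 1. The algorithm $\mathsf{StreamAlg}$ (all arithmetic mod the ciphertext modulus $q\in\mathrm{poly}(n)$, $q\gg nN$): Setup$(n)$: run $\mathsf{StreamAlg}_0$.Setup$(n)$; let $\ell=\lceil\log n\rceil$ and for $i\in[n]$ let $C_i:\{0,1\}^\ell\to\{0,1\}$ output 1 iff its input is the bit representation of $i$; sample $\tilde{\mathsf{pk}}\leftarrow\mathcal D_{\tilde{\mathsf{pk}}(\lambda)}$ and $\tilde{\mathsf{ct}}_1,\dots,\tilde{\mathsf{ct}}_\ell\leftarrow\mathcal D_{\tilde{\mathsf{ct}}(\lambda)}$; store them and set $sketch:=0$. Update$(i_t,\Delta_t)$: run $\mathsf{StreamAlg}_0$.Update$(i_t,\Delta_t)$; compute $\hat{\mathsf{ct}}_{i_t}\leftarrow\mathrm{Eval}(\tilde{\mathsf{pk}},C_{i_t},\tilde{\mathsf{ct}}_1,\dots,\tilde{\mathsf{ct}}_\ell)$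 and set $sketch\leftarrow sketch+\Delta_t\hat{\mathsf{ct}}_{i_t}$. Report$()$: let $\vec x'\leftarrow\mathsf{StreamAlg}_0$.Report$()$; if $\|\vec x'\|_0>k$ output $\bot$; otherwise compute $\hat{\mathsf{ct}}_i\leftarrow\mathrm{Eval}(\tilde{\mathsf{pk}},C_i,\tilde{\mathsf{ct}}_1,\dots,\tilde{\mathsf{ct}}_\ell)$ for all $i\in[n]$ and $hash\leftarrow\sum_{i\in[n]}\hat{\mathsf{ct}}_i\vec x'_i$; output $\vec x'$ if $hash=sketch$ and $\bot$ otherwise. The condition $\mathcal T(\mathcal S(n))=\Omega(\mathrm{poly}(n))$ means $\mathcal T(\mathcal S(n))$ is at least any polynomial in $n$ (so that every polynomial-time adversary runs within time $\mathcal T(\lambda)$).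
   Formalization: Formalized with: ciphertext pseudorandomness (iii) required jointly with pk, i.e. (pk, sample) vs (pk, Enc(pk,μ)); S(n) polynomially bounded; StreamAlg_0 always outputs a vector with entries in {-N,…,N}. Without these the claim can fail. *)

(* Defs.v *)
From HB Require Import structures.
From mathcomp Require Import all_boot all_order all_algebra.
From mathcomp Require Import reals.

Set Implicit Arguments.
Unset Strict Implicit.
Unset Printing Implicit Defensive.

Import Order.TTheory GRing.Theory Num.Theory.

Local Open Scope ring_scope.

(** * Fixed-length binary encodings *)

HB.mixin Record isBitEncoded T := {
  blen : nat;
  benc : T -> seq bool;
  size_benc : forall x, size (benc x) = blen;
  benc_inj : injective benc
}.

#[short(type="encType")]
HB.structure Definition BitEncoded := {T of isBitEncoded T & Finite T}.

Arguments blen : clear implicits.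

(* Partial inverse of [benc]. *)
Definition bdec (T : encType) (s : seq bool) : option T :=
  [pick x : T | benc x == s].

(* The [w] low-order bits of [i], least significant bit first. *)
Fixpoint bin (w i : nat) : seq bool :=
  if w is w'.+1 then odd i :: bin w' i./2 else [::].

Lemma size_bin w i : size (bin w i) = w.
Proof. by elim: w i => //= w IHw i; rewrite IHw. Qed.

Lemma bin_inj w i j :
  (i < 2 ^ w)%N -> (j < 2 ^ w)%N -> bin w i = bin w j -> i = j.
Proof.
elim: w i j => [|w IHw] i j /=.
  by rewrite expn0 !ltnS !leqn0 => /eqP-> /eqP->.
rewrite expnS mul2n => lti ltj [eq_odd eq_half].
rewrite -(odd_double_half i) -(odd_double_half j) eq_odd.
by rewrite (IHw _ _ _ _ eq_half) // ltn_half_double.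
Qed.

Lemma cat_inj_size (s1 s2 t1 t2 : seq bool) :
  size s1 = size t1 -> s1 ++ s2 = t1 ++ t2 -> s1 = t1 /\ s2 = t2.
Proof. by move=> eq_sz /eqP; rewrite eqseq_cat // => /andP[/eqP-> /eqP->]. Qed.

Section BlockEncoding.
Variables (I : eqType) (T : encType).
Implicit Types (f g : I -> T) (r : seq I).

Definition benc_blocks r f : seq bool := flatten [seq benc (f i) | i <- r].

Lemma size_benc_blocks r f : size (benc_blocks r f) = (size r * blen T)%N.
Proof.
by elim: r => //= i r IHr; rewrite /benc_blocks /= size_cat -/(benc_blocks r f)
  IHr size_benc mulSn.
Qed.

Lemma benc_blocks_inj r f g :
  benc_blocks r f = benc_blocks r g -> {in r, f =1 g}.
Proof.
elim: r => [|i r IHr] //= /cat_inj_size[]; first by rewrite !size_benc.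
move=> /benc_inj eq_i /IHr eq_r j; rewrite inE => /predU1P[-> //|].
exact: eq_r.
Qed.

End BlockEncoding.

Section Instances.

Definition benc_unit (_ : unit) : seq bool := [::].
Fact size_benc_unit x : size (benc_unit x) = 0%N. Proof. by []. Qed.
Fact benc_unit_inj : injective benc_unit. Proof. by case=> [] []. Qed.
HB.instance Definition _ := isBitEncoded.Build unit size_benc_unit benc_unit_inj.

Definition benc_bool (b : bool) : seq bool := [:: b].
Fact size_benc_bool b : size (benc_bool b) = 1%N. Proof. by []. Qed.
Fact benc_bool_inj : injective benc_bool. Proof. by move=> b c []. Qed.
HB.instance Definition _ := isBitEncoded.Build bool size_benc_bool benc_bool_inj.

Definition benc_ord n (i : 'I_n) : seq bool := bin (up_log 2 n) i.
Fact size_benc_ord n (i : 'I_n) : size (benc_ord i) = up_log 2 n.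
Proof. exact: size_bin. Qed.
Fact benc_ord_inj n : injective (@benc_ord n).
Proof.
move=> i j eq_ij; apply/val_inj/(bin_inj _ _ eq_ij) => /=;
  exact: leq_trans (ltn_ord _) (up_logP _ _).
Qed.
HB.instance Definition _ n :=
  isBitEncoded.Build 'I_n (@size_benc_ord n) (@benc_ord_inj n).

Definition benc_pair (A B : encType) (x : A * B) : seq bool :=
  benc x.1 ++ benc x.2.
Fact size_benc_pair (A B : encType) (x : A * B) :
  size (benc_pair x) = (blen A + blen B)%N.
Proof. by rewrite size_cat !size_benc. Qed.
Fact benc_pair_inj (A B : encType) : injective (@benc_pair A B).
Proof.
move=> [a b] [a' b'] /cat_inj_size[]; first by rewrite !size_benc.
by move=> /benc_inj /= -> /benc_inj /= ->.
Qed.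
HB.instance Definition _ (A B : encType) :=
  isBitEncoded.Build (A * B)%type (@size_benc_pair A B) (@benc_pair_inj A B).

(* A tag bit, then the payload padded to the length of the longer summand. *)
Definition benc_sum (A B : encType) (x : A + B) : seq bool :=
  match x with
  | inl a => true :: benc a ++ nseq (maxn (blen A) (blen B) - blen A) false
  | inr b => false :: benc b ++ nseq (maxn (blen A) (blen B) - blen B) false
  end.
Fact size_benc_sum (A B : encType) (x : A + B) :
  size (benc_sum x) = (maxn (blen A) (blen B)).+1.
Proof.
by case: x => x /=; rewrite size_cat size_benc size_nseq subnKC //
  ?leq_maxl ?leq_maxr.
Qed.
Fact benc_sum_inj (A B : encType) : injective (@benc_sum A B).
Proof.
move=> [a|b] [a'|b'] //= [] /cat_inj_size[]; rewrite ?size_benc //;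
  by move=> /benc_inj->.
Qed.
HB.instance Definition _ (A B : encType) :=
  isBitEncoded.Build (A + B)%type (@size_benc_sum A B) (@benc_sum_inj A B).

Definition benc_option (A : encType) (x : option A) : seq bool :=
  if x is Some a then true :: benc a else false :: nseq (blen A) false.
Fact size_benc_option (A : encType) (x : option A) : size (benc_option x) = (blen A).+1.
Proof. by case: x => [a|] /=; rewrite ?size_benc ?size_nseq. Qed.
Fact benc_option_inj (A : encType) : injective (@benc_option A).
Proof. by move=> [a|] [b|] //= [] /benc_inj->. Qed.
HB.instance Definition _ (A : encType) :=
  isBitEncoded.Build (option A) (@size_benc_option A) (@benc_option_inj A).

Definition benc_tuple n (A : encType) (t : n.-tuple A) : seq bool :=
  benc_blocks (enum 'I_n) (tnth t).
Fact size_benc_tuple n (A : encType) (t : n.-tuple A) :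
  size (benc_tuple t) = (n * blen A)%N.
Proof. by rewrite size_benc_blocks size_enum_ord. Qed.
Fact benc_tuple_inj n (A : encType) : injective (@benc_tuple n A).
Proof.
move=> t u /benc_blocks_inj eq_tu; apply: eq_from_tnth => i.
by apply: eq_tu; rewrite mem_enum.
Qed.
HB.instance Definition _ n (A : encType) :=
  isBitEncoded.Build (n.-tuple A) (@size_benc_tuple n A) (@benc_tuple_inj n A).

Definition benc_ffun n (A : encType) (f : {ffun 'I_n -> A}) : seq bool :=
  benc_blocks (enum 'I_n) f.
Fact size_benc_ffun n (A : encType) (f : {ffun 'I_n -> A}) :
  size (benc_ffun f) = (n * blen A)%N.
Proof. by rewrite size_benc_blocks size_enum_ord. Qed.
Fact benc_ffun_inj n (A : encType) : injective (@benc_ffun n A).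
Proof.
move=> f g /benc_blocks_inj eq_fg; apply/ffunP => i.
by apply: eq_fg; rewrite mem_enum.
Qed.
HB.instance Definition _ n (A : encType) :=
  isBitEncoded.Build {ffun 'I_n -> A} (@size_benc_ffun n A)
    (@benc_ffun_inj n A).

Definition benc_mx m n (A : encType) (M : 'M[A]_(m, n)) : seq bool :=
  benc_blocks (enum {: 'I_m * 'I_n}) (fun ij => M ij.1 ij.2).
Fact size_benc_mx m n (A : encType) (M : 'M[A]_(m, n)) :
  size (benc_mx M) = (m * n * blen A)%N.
Proof. by rewrite size_benc_blocks -cardE card_prod !card_ord. Qed.
Fact benc_mx_inj m n (A : encType) : injective (@benc_mx m n A).
Proof.
move=> M K /benc_blocks_inj eq_MK; apply/matrixP => i j.
by apply: (eq_MK (i, j)); rewrite mem_enum.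
Qed.
HB.instance Definition _ m n (A : encType) :=
  isBitEncoded.Build 'M[A]_(m, n) (@size_benc_mx m n A) (@benc_mx_inj m n A).

End Instances.

(** * Boolean circuits *)

(* Gates are numbered after the input wires and may read any earlier wire;
   reading a wire that does not exist yet returns [false]. *)
Inductive gate := GConst of bool | GNot of nat | GAnd of nat & nat.

Record circuit := Circuit { gates : seq gate; outs : seq nat }.

Definition gate_val (ws : seq bool) (g : gate) : bool :=
  match g with
  | GConst b => b
  | GNot i => ~~ nth false ws i
  | GAnd i j => nth false ws i && nth false ws j
  end.

Definition wires (gs : seq gate) (x : seq bool) : seq bool :=
  foldl (fun ws g => rcons ws (gate_val ws g)) x gs.

Definition ceval (C : circuit) (x : seq bool) : seq bool :=
  [seq nth false (wires (gates C) x) i | i <- outs C].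

Definition csize (C : circuit) : nat := size (gates C) + size (outs C).

Definition gate_depth (ds : seq nat) (g : gate) : nat :=
  match g with
  | GConst _ => 0
  | GNot i => (nth 0 ds i).+1
  | GAnd i j => (maxn (nth 0 ds i) (nth 0 ds j)).+1
  end.

Definition cdepth (m : nat) (C : circuit) : nat :=
  let ds := foldl (fun ds g => rcons ds (gate_depth ds g)) (nseq m 0%N) (gates C)
  in \max_(i <- outs C) nth 0%N ds i.

Definition gate_wf (w : nat) (g : gate) : bool :=
  match g with
  | GConst _ => true
  | GNot i => (i < w)%N
  | GAnd i j => (i < w)%N && (j < w)%N
  end.

(* [C] is a circuit {0,1}^m -> {0,1}^k. *)
Definition circuit_wf (m k : nat) (C : circuit) : bool :=
  [&& all (fun j => gate_wf (m + j) (nth (GConst false) (gates C) j))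
          (iota 0 (size (gates C))),
      all (fun i => i < m + size (gates C))%N (outs C)
    & size (outs C) == k].

Definition computes (A B : encType) (C : circuit) (f : A -> B) : Prop :=
  forall a, ceval C (benc a) = benc (f a).

(* The point function at [i] on [l] bits: wire [l] is the constant true, and
   wire [l + 2 j] is the conjunction of the first [j] bit comparisons. *)
Fixpoint point_gates (l j : nat) (bs : seq bool) : seq gate :=
  if bs is b :: bs' then
    [:: (if b then GAnd j j else GNot j); GAnd (l + j.*2) (l + j.*2).+1]
      ++ point_gates l j.+1 bs'
  else [::].

Definition point_circuit (l i : nat) : circuit :=
  Circuit (GConst true :: point_gates l 0 (bin l i)) [:: (l + l.*2)%N].

Lemma wires_cat gs1 gs2 x : wires (gs1 ++ gs2) x = wires gs2 (wires gs1 x).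
Proof. exact: foldl_cat. Qed.

Lemma point_gatesP l bs j ws :
    size ws = (l + j.*2).+1 -> (j + size bs)%N = l ->
  nth false (wires (point_gates l j bs) ws) (l + l.*2)
    = nth false ws (l + j.*2) && (take (size bs) (drop j ws) == bs).
Proof.
elim: bs j ws => [|b bs IHbs] j ws szw /=.
  by rewrite addn0 => <-; rewrite take0 eqxx andbT.
move=> eq_l; have ltj : (j < size ws)%N.
  by rewrite szw ltnS (leq_trans _ (leq_addl _ _)) // -addnn leq_addr.
have ltj1 : (j.+1 + size bs <= size ws)%N.
  by rewrite addSnnS eq_l szw leqW // leq_addr.
set lit := gate_val ws (if b then GAnd j j else GNot j).
have litE : lit = (nth false ws j == b).
  by rewrite /lit; case: (b) => /=; rewrite ?andbb; case: nth.
rewrite /wires /= -/lit -/(wires _ _) IHbs; first last.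
- by rewrite addSnnS.
- by rewrite !size_rcons szw doubleS !addnS.
rewrite doubleS !addnS nth_rcons size_rcons szw ltnn eqxx /= !nth_rcons szw.
rewrite ltnSn ltnn eqxx (drop_nth false ltj) /= eqseq_cons andbA litE.
congr (_ && (_ == _)); rewrite -!cats1 -catA drop_cat.
case: ltnP => [_|le_sz].
  by rewrite takel_cat // size_drop leq_subRL.
have bs0 : size bs = 0%N.
  by apply/eqP; rewrite -leqn0 -(leq_add2l (size ws)) addn0
    (leq_trans _ ltj1) // leq_add2r.
by rewrite bs0 !take0.
Qed.

Lemma point_circuitP l i b :
  size b = l -> ceval (point_circuit l i) b = [:: b == bin l i].
Proof.
move=> szb; rewrite /ceval /= /wires /= -/(wires _ _) point_gatesP.
- rewrite addn0 -cats1 nth_cat szb ltnn subnn /= drop0 size_bin.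
  by rewrite take_cat szb ltnn subnn take0 cats0.
- by rewrite size_rcons szb addn0.
- by rewrite add0n size_bin.
Qed.

(** * Asymptotics *)

Definition poly_bounded (f : nat -> nat) : Prop :=
  exists c : nat, forall n, (f n <= n ^ c + c)%N.

Definition negligible (R : realType) (f : nat -> R) : Prop :=
  forall c : nat, (0 < c)%N ->
    exists n0 : nat, forall n, (n0 < n)%N -> f n < n%:R ^- c.

(* Running time is circuit size.  For the algorithms assumed to be efficient,
   non-uniform polynomial size is implied by polynomial time. *)
Definition poly_time (A B : nat -> encType) (f : forall n, A n -> B n) : Prop :=
  exists c : nat, forall n,
    (blen (A n) <= n ^ c + c)%N /\
    exists2 C, (csize C <= n ^ c + c)%N & computes C (f n).

(** * Finite probability *)

Section Probability.
Variable R : realType.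

Record fdist (T : finType) := FDist {
  pmf :> T -> R;
  pmf_ge0 : forall x, 0 <= pmf x;
  pmf_sum1 : \sum_x pmf x = 1
}.

(* Expectation; the probability of [P] is [E d (fun x => (P x)%:R)]. *)
Definition E (T : finType) (d : fdist T) (f : T -> R) : R :=
  \sum_x d x * f x.

Section Constructions.
Variables (A B : finType).

Fact dret_ge0 (a : A) x : 0 <= ((x == a)%:R : R). Proof. exact: ler0n. Qed.
Fact dret_sum1 (a : A) : \sum_x ((x == a)%:R : R) = 1.
Proof. by rewrite (bigD1 a) //= eqxx big1 ?addr0 // => x /negPf->. Qed.
Definition dret (a : A) : fdist A := FDist (dret_ge0 a) (dret_sum1 a).

Fact dbind_ge0 (d : fdist A) (f : A -> fdist B) y : 0 <= \sum_x d x * f x y.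
Proof. by apply: sumr_ge0 => x _; rewrite mulr_ge0 ?pmf_ge0. Qed.
Fact dbind_sum1 (d : fdist A) (f : A -> fdist B) :
  \sum_y \sum_x d x * f x y = 1.
Proof.
rewrite exchange_big /= -[RHS](pmf_sum1 d); apply: eq_bigr => x _.
by rewrite -mulr_sumr pmf_sum1 mulr1.
Qed.
Definition dbind (d : fdist A) (f : A -> fdist B) : fdist B :=
  FDist (dbind_ge0 d f) (dbind_sum1 d f).

Fact unif_ge0 (x : A) : 0 <= (#|A|%:R^-1 : R).
Proof. by rewrite invr_ge0 ler0n. Qed.
Fact unif_sum1 (x0 : A) : \sum_(x : A) (#|A|%:R^-1 : R) = 1.
Proof.
have card_neq0 : (#|A|%:R : R) != 0.
  by rewrite pnatr_eq0 -lt0n; apply/card_gt0P; exists x0.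
by rewrite sumr_const -(mulr_natl _^-1) divff.
Qed.
(* [x0] only witnesses that [A] is inhabited. *)
Definition unif (x0 : A) : fdist A := FDist unif_ge0 (unif_sum1 x0).

Fact diid_ge0 (d : fdist A) l (f : {ffun 'I_l -> A}) : 0 <= \prod_i d (f i).
Proof. by apply: prodr_ge0 => i _; apply: pmf_ge0. Qed.
Fact diid_sum1 (d : fdist A) l : \sum_(f : {ffun 'I_l -> A}) \prod_i d (f i) = 1.
Proof. by rewrite -(bigA_distr_bigA (fun=> d)) big1 // => i _; apply: pmf_sum1. Qed.
Definition diid (d : fdist A) l : fdist {ffun 'I_l -> A} :=
  FDist (@diid_ge0 d l) (diid_sum1 d l).

End Constructions.

Definition dmap (A B : finType) (f : A -> B) (d : fdist A) : fdist B :=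
  dbind d (fun a => dret (f a)).

Definition dpair (A B : finType) (d : fdist A) (e : fdist B) : fdist (A * B)%type :=
  dbind d (fun a => dmap (fun b => (a, b)) e).

Definition coins (r : nat) : fdist (r.-tuple bool) := unif (nseq_tuple r false).

(** * Time-bounded distinguishers *)

(* A probabilistic circuit reads its random bits after its input. *)
Record pcircuit := PCircuit { pcoins : nat; pcirc : circuit }.

Definition pcost (D : pcircuit) : nat := pcoins D + csize (pcirc D).

Definition pout (A : encType) (D : pcircuit) (a : A) (w : seq bool) : bool :=
  head false (ceval (pcirc D) (benc a ++ w)).

Definition accept (A : encType) (D : pcircuit) (a : A) : R :=
  E (coins (pcoins D)) (fun w => (pout D a w)%:R).

(* Since [lam0] does not depend on the adversary, the bound concerns every
   adversary at each fixed [lam]; its description must count towards its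
   running time, as circuit size does, or any finite function could be
   hardwired into it. *)
Definition indistinguishable (T : nat -> nat) (eps : nat -> R)
    (A : nat -> encType) (X Y : forall lam, fdist (A lam)) : Prop :=
  exists lam0 : nat, forall lam, (lam0 < lam)%N ->
    forall D : pcircuit, (pcost D <= T lam)%N ->
      `|E (X lam) (accept D) - E (Y lam) (accept D)| <= eps lam.

End Probability.

Arguments coins {R} r.
Arguments dret {R A} a.

(** * Fully homomorphic encryption *)

(* The ciphertexts, fresh or evaluated, are vectors over Z_q, and Eval is
   deterministic, as required of pseudorandom schemes.  Randomized algorithms
   take their coins as last argument. *)
Record fhe := FHE {
  pklen : nat -> nat;
  sklen : nat -> nat;
  modulus : nat -> nat;
  modulus_gt1 : forall lam, (1 < modulus lam)%N;
  ctdim : nat -> nat;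
  setup_coins : nat -> nat;
  enc_coins : nat -> nat;
  dec_coins : nat -> nat;
  fhe_setup : forall lam, (setup_coins lam).-tuple bool ->
    (pklen lam).-tuple bool * (sklen lam).-tuple bool;
  fhe_enc : forall lam, (pklen lam).-tuple bool -> bool ->
    (enc_coins lam).-tuple bool -> 'rV['Z_(modulus lam)]_(ctdim lam);
  fhe_eval : forall lam, (pklen lam).-tuple bool -> circuit -> forall l,
    {ffun 'I_l -> 'rV['Z_(modulus lam)]_(ctdim lam)} ->
    'rV['Z_(modulus lam)]_(ctdim lam);
  fhe_dec : forall lam, (pklen lam).-tuple bool -> (sklen lam).-tuple bool ->
    'rV['Z_(modulus lam)]_(ctdim lam) -> (dec_coins lam).-tuple bool -> bool
}.

Notation pk_t F lam := ((pklen F lam).-tuple bool).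
Notation sk_t F lam := ((sklen F lam).-tuple bool).
Notation ct_t F lam := 'rV['Z_(modulus F lam)]_(ctdim F lam).

Section FHE.
Variable F : fhe.

Definition fhe_efficient : Prop :=
  [/\ poly_time (fun lam (w : (setup_coins F lam).-tuple bool) => fhe_setup w),
      poly_time (fun lam
        (a : pk_t F lam * bool * (enc_coins F lam).-tuple bool) =>
          fhe_enc a.1.1 a.1.2 a.2),
      poly_time (fun lam
        (a : pk_t F lam * sk_t F lam * ct_t F lam
             * (dec_coins F lam).-tuple bool) =>
          fhe_dec a.1.1.1 a.1.1.2 a.1.2 a.2)
    & forall d, poly_bounded d -> exists c : nat, forall lam l C,
        circuit_wf l 1 C -> (cdepth l C <= d lam)%N ->
        exists2 C', (csize C' <= (lam + l + csize C) ^ c + c)%N &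
          computes C' (fun a : pk_t F lam * {ffun 'I_l -> ct_t F lam} =>
                         fhe_eval a.1 C a.2)].

Definition fhe_compact : Prop := poly_bounded (fun lam => blen (ct_t F lam)).

Definition enc_all lam (pk : pk_t F lam) l (b : l.-tuple bool)
    (r : 'I_l -> (enc_coins F lam).-tuple bool) : {ffun 'I_l -> ct_t F lam} :=
  [ffun j => fhe_enc pk (tnth b j) (r j)].

(* "Depth at most poly(lam)" is read as: for every polynomial bound [d], for all
   large enough [lam].  Without the threshold, [d] could be chosen after the
   circuit and would bound nothing.  All coins are uniform, so probability 1
   means for all coins. *)
Definition fhe_correct : Prop :=
  forall d, poly_bounded d -> exists lam0 : nat, forall lam, (lam0 <= lam)%N ->
  forall (w : (setup_coins F lam).-tuple bool) (l : nat) (C : circuit)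
         (b : l.-tuple bool) (r : 'I_l -> (enc_coins F lam).-tuple bool)
         (v : (dec_coins F lam).-tuple bool),
    circuit_wf l 1 C -> (cdepth l C <= d lam)%N ->
    let: (pk, sk) := fhe_setup w in
    [:: fhe_dec pk sk (fhe_eval pk C (enc_all pk b r)) v] = ceval C b.

(* A ciphertext in the domain of Dec: an honestly evaluated one. *)
Definition evaluated (d : nat -> nat) lam (pk : pk_t F lam) (ct : ct_t F lam) :
    Prop :=
  exists (l : nat) (C : circuit) (b : l.-tuple bool)
         (r : 'I_l -> (enc_coins F lam).-tuple bool),
    [/\ circuit_wf l 1 C, (cdepth l C <= d lam)%N
      & ct = fhe_eval pk C (enc_all pk b r)].

Variable R : realType.

Definition guess_prob lam (D : pcircuit) : R :=
  E (coins (setup_coins F lam)) (fun w =>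
  E (unif R true) (fun b =>
  E (coins (enc_coins F lam)) (fun r =>
  E (coins (pcoins D)) (fun v =>
    let pk := (fhe_setup w).1 in
    (pout D (pk, fhe_enc pk b r) v == b)%:R)))).

Definition fhe_secure (T : nat -> nat) (eps : nat -> R) : Prop :=
  exists lam0 : nat, forall lam, (lam0 < lam)%N ->
    forall D : pcircuit, (pcost D <= T lam)%N ->
      2 * `|1 / 2 - guess_prob lam D| <= eps lam.

(* The explicit distributions and the linear decryption algorithm.  The relation
   [a << q] of the linear homomorphism is [margin * a <= q], where [margin] is
   determined by the scheme (its noise growth).  The value decoded by
   [linear_dec] is then at most [q] in absolute value; see [bval] below. *)
Record pseudorandomness := Pseudorandomness {
  dist_pk : forall lam, fdist R (pk_t F lam);
  dist_ct : forall lam, fdist R (ct_t F lam);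
  margin : nat -> nat;
  margin_gt0 : forall lam, (0 < margin lam)%N;
  linear_dec : forall lam, (pklen F lam).-tuple bool ->
    (sklen F lam).-tuple bool -> 'rV['Z_(modulus F lam)]_(ctdim F lam) ->
    'I_(modulus F lam).*2.+1
}.

Definition law_pk lam : fdist R (pk_t F lam) :=
  dmap (fun w => (fhe_setup w).1) (coins (setup_coins F lam)).

Definition law_pk_enc (mu : bool) lam : fdist R (pk_t F lam * ct_t F lam)%type :=
  dbind (coins (setup_coins F lam)) (fun w =>
    dmap (fun r => ((fhe_setup w).1, fhe_enc (fhe_setup w).1 mu r))
         (coins (enc_coins F lam))).

End FHE.

(* [bval M] identifies 'I_(2 M + 1) with the integer interval [-M, M]. *)
Definition bval (M : nat) (i : 'I_M.*2.+1) : int := i%:Z - M%:Z.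

Definition linear_homomorphic (R : realType) (F : fhe)
    (P : pseudorandomness F R) : Prop :=
  poly_time (fun lam (a : pk_t F lam * sk_t F lam * ct_t F lam) =>
    linear_dec P a.1.1 a.1.2 a.2) /\
  forall d, poly_bounded d -> exists lam0 : nat, forall lam, (lam0 <= lam)%N ->
  forall (w : (setup_coins F lam).-tuple bool) (m : nat) (x : 'I_m -> int)
         (ct : 'I_m -> ct_t F lam) (v : 'I_m -> (dec_coins F lam).-tuple bool),
    let: (pk, sk) := fhe_setup w in
    (forall i, evaluated d pk (ct i)) ->
    (margin P lam * (m * \max_i `|x i|%N) <= modulus F lam)%N ->
    bval (linear_dec P pk sk (\sum_i ct i *~ x i))
      = \sum_i x i * (fhe_dec pk sk (ct i) (v i))%:Z.

(* Whoever is to tell encryptions from samples of [dist_ct] is given the public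
   key under which the encryption was made. *)
Definition pseudorandom_fhe (R : realType) (T : nat -> nat) (eps : nat -> R)
    (F : fhe) (P : pseudorandomness F R) : Prop :=
  [/\ [/\ fhe_efficient F, fhe_compact F & fhe_correct F],
      indistinguishable T eps (dist_pk P) (law_pk F R),
      forall mu : bool, indistinguishable T eps
        (fun lam => dpair (law_pk F R lam) (dist_ct P lam)) (law_pk_enc F R mu)
    & linear_homomorphic P].

(** * Streaming *)

(* An update (i, Delta); since both the old and the new entry lie in [-N, N],
   Delta lies in [-2N, 2N]. *)
Notation upd_t n N := ('I_n * 'I_N.*2.*2.+1)%type.

(* An output vector, with entries in [-N, N]. *)
Notation vec_t n N := 'rV['I_N.*2.+1]_n.

Definition vval n N (x : vec_t n N) : 'rV[int]_n := map_mx (@bval N) x.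

Definition apply_upd n N (x : 'rV[int]_n) (u : upd_t n N) : 'rV[int]_n :=
  x + bval u.2 *: delta_mx 0 u.1.

Definition in_range n (N : nat) (x : 'rV[int]_n) : bool :=
  [forall i, (absz (x 0%R i) <= N)%N].

Definition stream_vec n N (us : seq (upd_t n N)) : 'rV[int]_n :=
  foldl (@apply_upd n N) 0 us.

Definition stream_ok n N (us : seq (upd_t n N)) : Prop :=
  forall t, (t <= size us)%N -> in_range N (stream_vec (take t us)).

Definition norm0 n (x : 'rV[int]_n) : nat := #|[set i | x 0 i != 0]|.

(* Deterministic streaming algorithms that always output a vector. *)
Record det_stream_alg (n N : nat) := DetStreamAlg {
  det_state : encType;
  det_setup : det_state;
  det_update : det_state -> upd_t n N -> det_state;
  det_report : det_state -> vec_t n N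
}.

Definition det_poly_time (N : nat -> nat)
    (A : forall n, det_stream_alg n (N n)) : Prop :=
  poly_time (fun n (a : det_state (A n) * upd_t n (N n)) =>
    det_update a.1 a.2) /\
  poly_time (fun n (s : det_state (A n)) => det_report s).

Definition relaxed_sparse_recovery (N k Tmax : nat -> nat)
    (A : forall n, det_stream_alg n (N n)) : Prop :=
  forall n (us : seq (upd_t n (N n))),
    (size us <= Tmax n)%N -> stream_ok us ->
    (norm0 (stream_vec us) <= k n)%N ->
    vval (det_report (foldl (@det_update _ _ (A n)) (det_setup (A n)) us))
      = stream_vec us.

Section Robustness.
Variable R : realType.

(* Randomized streaming algorithms whose answers are a vector or [None] (bot).
   Each call receives a fresh draw from the given distribution; this draw is the
   randomness that the call uses. *)
Record stream_alg (n N : nat) := StreamAlg {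
  state : encType;
  setup_rand : encType;
  update_rand : encType;
  report_rand : encType;
  setup_dist : fdist R setup_rand;
  update_dist : fdist R update_rand;
  report_dist : fdist R report_rand;
  setup : setup_rand -> state;
  update : state -> upd_t n N -> update_rand -> state;
  report : state -> report_rand -> option (vec_t n N)
}.

Definition sparse_recovery_correct n N (k : nat) (x : 'rV[int]_n)
    (o : option (vec_t n N)) : bool :=
  omap (@vval n N) o == (if (norm0 x <= k)%N then Some x else None).

(* In each round the adversary reads its own memory, the current state of the
   algorithm, the last event and fresh coins; it writes its new memory and an
   action, [Some u] for an update and [None] for a query.  It leaves the game by
   writing an invalid action. *)
Record adversary := Adversary {
  adv_mem : nat;
  adv_coins : nat;
  adv_rounds : nat;
  adv_step : circuit
}.

Definition adv_time (A : adversary) : nat :=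
  adv_mem A + adv_rounds A * (adv_coins A + csize (adv_step A)).

Section Game.
Variables (n N Tmax : nat) (correct : 'rV[int]_n -> option (vec_t n N) -> bool).
Variables (S : stream_alg n N) (A : adversary).

(* What a call reveals besides the resulting state: the randomness it used and,
   for a query, the answer. *)
Definition event : encType :=
  (setup_rand S + (update_rand S + report_rand S * option (vec_t n N)))%type.

(* The probability that one of the queries of the next [m] rounds is answered
   incorrectly, when the memory of the adversary is [mem], the state is [s], the
   last event is [e], and [t] updates have led to the vector [x].  An update
   that exceeds the length of the stream or the range of the entries ends the
   game. *)
Fixpoint play (m : nat) (mem : seq bool) (s : state S) (e : event)
    (t : nat) (x : 'rV[int]_n) : R :=
  if m is m'.+1 then
    E (coins (adv_coins A)) (fun w =>
      let out := ceval (adv_step A) (mem ++ benc s ++ benc e ++ w) in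
      let mem' := take (adv_mem A) out in
      match bdec (option (upd_t n N)) (drop (adv_mem A) out) with
      | None => 0
      | Some None =>
          E (report_dist S) (fun r =>
            let o := report s r in
            if correct x o then play m' mem' s (inr (inr (r, o))) t x else 1)
      | Some (Some u) =>
          let x' := apply_upd x u in
          if (t < Tmax)%N && in_range N x' then
            E (update_dist S) (fun r =>
              play m' mem' (update s u r) (inr (inl r)) t.+1 x')
          else 0
      end)
  else 0.

Definition fail_prob : R :=
  E (setup_dist S) (fun r =>
    play (adv_rounds A) (nseq (adv_mem A) false) (setup r) (inl r) 0 0).

End Game.

(* PPT adversaries are families of probabilistic circuits of polynomial size,
   which include the uniform ones. *)
Definition white_box_robust (N Tmax : nat -> nat)
    (correct : forall n, 'rV[int]_n -> option (vec_t n (N n)) -> bool)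
    (S : forall n, stream_alg n (N n)) : Prop :=
  forall A : nat -> adversary, poly_bounded (fun n => adv_time (A n)) ->
    negligible (fun n => fail_prob (Tmax n) (@correct n) (S n) (A n)).

(** * The algorithm *)

(* Coordinates are numbered from 0, so their indices fit in this many bits. *)
Definition index_len (n : nat) : nat := up_log 2 n.

Section Construction.
Variables (F : fhe) (P : pseudorandomness F R).
Variables (n N k lam : nat) (A0 : det_stream_alg n N).

(* The stored public key and ciphertexts. *)
Definition hash_key : encType :=
  (pk_t F lam * {ffun 'I_(index_len n) -> ct_t F lam})%type.

Definition index_ct (h : hash_key) (i : 'I_n) : ct_t F lam :=
  fhe_eval h.1 (point_circuit (index_len n) i) h.2.

Definition sa_state : encType := (det_state A0 * hash_key * ct_t F lam)%type.

Definition sa_setup (h : hash_key) : sa_state := (det_setup A0, h, 0).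

Definition sa_update (s : sa_state) (u : upd_t n N) (_ : unit) : sa_state :=
  let: (s0, h, sketch) := s in
  (det_update s0 u, h, sketch + index_ct h u.1 *~ bval u.2).

Definition sa_report (s : sa_state) (_ : unit) : option (vec_t n N) :=
  let: (s0, h, sketch) := s in
  let x' := det_report s0 in
  if (k < norm0 (vval x'))%N then None
  else
    let hash := \sum_(i < n) index_ct h i *~ vval x' 0 i in
    if hash == sketch then Some x' else None.

Definition stream_alg_of : stream_alg n N :=
  StreamAlg (dpair (dist_pk P lam) (diid (dist_ct P lam) (index_len n)))
    (dret tt) (dret tt) sa_setup sa_update sa_report.

End Construction.

End Robustness.

(* Main.v *)
Require Import Defs.
From mathcomp Require Import all_boot all_order all_algebra.
From mathcomp Require Import reals.
From mathcomp Require Import zify lra.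

Set Implicit Arguments.
Unset Strict Implicit.
Unset Printing Implicit Defensive.

Import Order.TTheory GRing.Theory Num.Theory.

(** If the true vector [x] is [k]-sparse, the answer is correct because the
    sketch is a linear function of [x].  So an incorrect answer is some
    [x' <> x] with [\sum_i x_i ct_i = \sum_i x'_i ct_i], where [ct_i] is the
    evaluation of the [i]-th point circuit on the stored ciphertexts.  If these
    were real encryptions of the bits of an index [m], then [linear_dec] would
    turn this equation into [x_m = x'_m].  So an adversary that forces
    [x'_m <> x_m] tells the sampled key from a real one, and a hybrid argument
    over the public key and the [index_len n] ciphertexts bounds its success
    probability, for every [m], by [(index_len n + 1) * eps].  The coins of the
    adversary and the samples that are common to two consecutive hybrids are
    hardwired, so that the distinguishers are deterministic.

    A distinguisher runs the whole game on its input.  Its circuit has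
    polynomial size because [q] and [N] are polynomial in [n]: all arithmetic is
    done by truth tables on [O(log n)] bits.

    The point circuits have depth [O(log n)], while the scheme supports depths
    polynomial in [lam].  That [log n] is polynomial in [lam = S n] follows from
    security: a truth table of size [2 ^ poly lam] breaks the scheme, so
    [n <= T (S n) < 2 ^ poly (S n)]. *)

Local Open Scope nat_scope.

(** * Combining circuits *)

Definition rename_gate (f : nat -> nat) (g : gate) : gate :=
  match g with
  | GConst b => GConst b
  | GNot i => GNot (f i)
  | GAnd i j => GAnd (f i) (f j)
  end.

(* Where the wires of a circuit go when its inputs are read from the wires
   [ins] of a circuit that already has [w] wires. *)
Definition rewire (ins : seq nat) (w i : nat) : nat :=
  if i < size ins then nth 0 ins i else i - size ins + w.

Lemma wires_rcons gs g x :
  wires (rcons gs g) x = rcons (wires gs x) (gate_val (wires gs x) g).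
Proof. by rewrite /wires foldl_rcons. Qed.

Lemma size_wires gs x : size (wires gs x) = size x + size gs.
Proof.
elim/last_ind: gs => [|gs g IH]; first by rewrite addn0.
by rewrite wires_rcons !size_rcons IH addnS.
Qed.

Lemma take_wires gs x : take (size x) (wires gs x) = x.
Proof.
elim/last_ind: gs => [|gs g IH]; first by rewrite take_size.
by rewrite wires_rcons -cats1 takel_cat // size_wires leq_addr.
Qed.

Lemma wiresE gs x : wires gs x = x ++ drop (size x) (wires gs x).
Proof. by rewrite -{2}(take_wires gs x) cat_take_drop. Qed.

Section Rewire.
Variables (ws x : seq bool) (ins : seq nat).
Hypothesis x_ins : x = [seq nth false ws i | i <- ins].
Hypothesis ins_ws : all (fun i => i < size ws) ins.

Lemma nth_rewire v i :
  nth false (ws ++ v) (rewire ins (size ws) i) = nth false (x ++ v) i.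
Proof.
have szx : size x = size ins by rewrite x_ins size_map.
rewrite /rewire [RHS]nth_cat szx.
case: (ltnP i (size ins)) => lti; rewrite nth_cat.
  by rewrite (all_nthP 0 ins_ws) // x_ins (nth_map 0).
by rewrite ltnNge leq_addl addnK.
Qed.

(** A rewired gate reads the same bits as the original one by [nth_rewire], so the new gates append
    exactly the gate values of the original run. The induction adds gates at the end because [wires]
    is a left fold. *)
Lemma wires_rewire gs :
  wires (map (rename_gate (rewire ins (size ws))) gs) ws
    = ws ++ drop (size x) (wires gs x).
Proof.
elim/last_ind: gs => [|gs g IH]; first by rewrite /= drop_size cats0.
rewrite map_rcons !wires_rcons IH drop_rcons ?size_wires ?leq_addr //.
rewrite -rcons_cat; congr rcons.
by case: g => [b|i|i j] //=; rewrite !nth_rewire -wiresE.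
Qed.

Lemma ceval_rewire C :
  [seq nth false (wires (map (rename_gate (rewire ins (size ws))) (gates C)) ws) i
     | i <- map (rewire ins (size ws)) (outs C)] = ceval C x.
Proof.
rewrite wires_rewire /ceval -map_comp; apply: eq_map => i /=.
by rewrite nth_rewire -wiresE.
Qed.

End Rewire.

(* [e] encodes the input and [f] computes the output bits. *)
Definition cx (X : Type) (e f : X -> seq bool) (s : nat) : Prop :=
  exists2 C, csize C <= s & forall x, ceval C (e x) = f x.

Section Combinators.
Variables (X : Type) (e : X -> seq bool) (m : nat).
Hypothesis size_e : forall x, size (e x) = m.
Implicit Types (f g : X -> seq bool).

Lemma cx_le f s t : s <= t -> cx e f s -> cx e f t.
Proof. by move=> le_st [C le_Cs eC]; exists C => //; apply: leq_trans le_st. Qed.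

Lemma cx_ext f g s : f =1 g -> cx e f s -> cx e g s.
Proof. by move=> fg [C le_Cs eC]; exists C => // x; rewrite eC. Qed.

(* A gate computing [false] stands in for the nonexistent wires read by [outs]. *)
Lemma ceval_clamp C w ws : size ws = w + size (gates C) ->
  [seq nth false (rcons ws false) i
     | i <- map (minn (w + size (gates C))) (outs C)]
    = [seq nth false ws i | i <- outs C].
Proof.
move=> szw; rewrite -map_comp; apply: eq_map => i; rewrite /comp nth_rcons szw.
case: (ltnP i (w + size (gates C))) => lti.
  by rewrite lti.
by rewrite ltnn eqxx nth_default // szw.
Qed.

Lemma clamp_lt w C :
  all (fun i => i < (w + size (gates C)).+1) (map (minn (w + size (gates C))) (outs C)).
Proof. by apply/allP => _ /mapP[i _ ->]; rewrite ltnS geq_minl. Qed.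

(** The second circuit has to be right only on the strings [e' (u x)]; with [e' := id] the
    intermediate value can be a raw bit string. The extra 1 is the constant gate that absorbs
    dangling outputs of the first circuit. *)
Lemma cx_comp (Y : Type) (e' : Y -> seq bool) (u : X -> Y) g s t :
  cx e (fun x => e' (u x)) s -> (exists2 C, csize C <= t & forall x, ceval C (e' (u x)) = g x) ->
  cx e g (s + t + 1).
Proof.
case=> [C1 le1 e1] [C2 le2 e2].
pose w := m + size (gates C1); pose ins := map (minn w) (outs C1).
exists (Circuit (rcons (gates C1) (GConst false)
                 ++ map (rename_gate (rewire ins w.+1)) (gates C2))
                (map (rewire ins w.+1) (outs C2))).
  rewrite /csize /= size_cat size_rcons !size_map.
  by move: le1 le2; rewrite /csize; lia.
move=> x; rewrite -e2 -e1 /ceval /= wires_cat wires_rcons /=.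
have szw : size (wires (gates C1) (e x)) = m + size (gates C1).
  by rewrite size_wires size_e.
have <- : size (rcons (wires (gates C1) (e x)) false) = w.+1.
  by rewrite size_rcons szw.
apply: (ceval_rewire (x := ceval C1 (e x))); first by rewrite /ins ceval_clamp.
by rewrite size_rcons szw; apply: clamp_lt.
Qed.

Lemma cx_cat f g s t : cx e f s -> cx e g t ->
  cx e (fun x => f x ++ g x) (s + t + 1).
Proof.
case=> [C1 le1 e1] [C2 le2 e2].
pose w := m + size (gates C1); pose ins := iota 0 m.
exists (Circuit (rcons (gates C1) (GConst false)
                 ++ map (rename_gate (rewire ins w.+1)) (gates C2))
                (map (minn w) (outs C1) ++ map (rewire ins w.+1) (outs C2))).
  rewrite /csize /= !size_cat size_rcons !size_map.
  by move: le1 le2; rewrite /csize; lia.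
move=> x; rewrite -e1 -e2 /ceval /= wires_cat wires_rcons /=.
have szw : size (wires (gates C1) (e x)) = m + size (gates C1).
  by rewrite size_wires size_e.
have <- : size (rcons (wires (gates C1) (e x)) false) = w.+1.
  by rewrite size_rcons szw.
rewrite map_cat.
have insE : e x = [seq nth false (rcons (wires (gates C1) (e x)) false) i | i <- ins].
  rewrite (wiresE (gates C1)) -cats1 -catA.
  apply: (@eq_from_nth _ false); first by rewrite size_map size_iota size_e.
  move=> i lti; rewrite (nth_map 0) ?size_iota -?(size_e x) //.
  by rewrite nth_iota ?size_e -?(size_e x) // add0n nth_cat lti.
have ltins : all (fun i => i < size (rcons (wires (gates C1) (e x)) false)) ins.
  apply/allP=> i; rewrite mem_iota add0n /= size_rcons szw => lti.
  by rewrite ltnS ltnW // (leq_trans lti) // leq_addr.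
rewrite (ceval_rewire insE ltins) (wires_rewire insE ltins) -(ceval_clamp szw); congr (_ ++ _).
rewrite -!map_comp; apply: eq_map => i; rewrite /comp.
by rewrite nth_cat size_rcons szw ltnS geq_minl.
Qed.

Lemma cx_proj (l : seq nat) : cx e (fun x => [seq nth false (e x) i | i <- l]) (size l).
Proof. by exists (Circuit [::] l). Qed.

Lemma cx_slice i w : i + w <= m -> cx e (fun x => take w (drop i (e x))) w.
Proof.
move=> le_m; apply: cx_le (leqnn _) _; rewrite -{2}(size_iota i w).
apply: cx_ext (cx_proj _) => x.
rewrite take_drop; apply: (@eq_from_nth _ false).
  by rewrite size_map size_iota size_drop size_take_min size_e; lia.
move=> j; rewrite size_map size_iota => ltj.
rewrite (nth_map 0) ?size_iota // nth_iota // nth_drop nth_take //.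
by rewrite addnC ltn_add2r.
Qed.

Lemma cx_id : cx e e m.
Proof.
by apply: cx_ext (cx_slice (i := 0) (leqnn _)) => x; rewrite drop0 -(size_e x) take_size.
Qed.

Lemma wires_const bs x : wires (map GConst bs) x = x ++ bs.
Proof.
elim/last_ind: bs => [|bs b IH]; first by rewrite cats0.
by rewrite map_rcons wires_rcons IH rcons_cat.
Qed.

Lemma cx_const bs : cx e (fun=> bs) (size bs).*2.
Proof.
exists (Circuit (map GConst bs) (iota m (size bs))).
  by rewrite /csize size_map size_iota addnn.
move=> x; rewrite /ceval /= wires_const -(size_e x).
apply: (@eq_from_nth _ false); first by rewrite size_map size_iota.
move=> i; rewrite size_map size_iota => lti.
by rewrite (nth_map 0) ?size_iota // nth_iota // nth_cat ltnNge leq_addr /= addKn.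
Qed.

Lemma cx_flatten (I : eqType) (r : seq I) (F : I -> X -> seq bool) s :
  {in r, forall i, cx e (F i) s} ->
  cx e (fun x => flatten [seq F i x | i <- r]) (size r * s.+1).
Proof.
elim: r => [|i r IH] Fs /=; first by exists (Circuit [::] [::]).
apply: cx_le (cx_cat (Fs i (mem_head _ _)) (IH _)) => [|j rj].
  by rewrite mulSn addn1 -addSn.
by apply: Fs; rewrite inE rj orbT.
Qed.

Lemma cx_if1 (a b c : X -> bool) s t u :
  cx e (fun x => [:: a x]) s -> cx e (fun x => [:: b x]) t ->
  cx e (fun x => [:: c x]) u ->
  cx e (fun x => [:: if a x then b x else c x]) (s + t + u + 11).
Proof.
move=> ha hb hc; have := cx_cat ha (cx_cat hb hc).
move/(cx_comp (e' := id) (u := fun x => [:: a x] ++ [:: b x] ++ [:: c x])).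
move=> /(_ (fun x => [:: if a x then b x else c x]) 8) h.
apply: cx_le (h _).
  by rewrite -!addnA !leq_add2l.
(* Wires 4 and 5 are [a && b] and [~~ a && c]; wire 9 is their disjunction by De Morgan. *)
exists (Circuit [:: GNot 0; GAnd 0 1; GAnd 3 2; GNot 4; GNot 5; GAnd 6 7; GNot 8] [:: 9]).
  by [].
by move=> x; rewrite /ceval /=; case: (a x) (b x) (c x) => [] [] [].
Qed.

Lemma cx_bit k f s : cx e f s -> 0 < s -> cx e (fun x => [:: nth false (f x) k]) s.
Proof.
case=> C le_Cs eC s_gt0; case: (ltnP k (size (outs C))) => ltk.
  exists (Circuit (gates C) [:: nth 0 (outs C) k]).
    by move: le_Cs; rewrite /csize /=; lia.
  by move=> x; rewrite -eC /ceval /= (nth_map 0).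
(* Without gates, wire [m] does not exist and reads as the default [false]. *)
exists (Circuit [::] [:: m]) => // x; rewrite /ceval /= nth_default ?size_e //.
by rewrite -eC nth_default // size_map.
Qed.

(* Shannon expansion along the bits read. *)
Lemma cx_table (l : seq nat) (g : seq bool -> bool) :
  cx e (fun x => [:: g [seq nth false (e x) i | i <- l]]) (14 * 2 ^ size l - 12).
Proof.
(* The sizes satisfy s(0) = 2 and s(l + 1) = 1 + 2 s(l) + 11, whose solution is 14 * 2 ^ l - 12. *)
elim: l g => [|i l IH] g; first exact: (cx_const [:: g [::]]).
have := cx_if1 (cx_proj [:: i]) (IH (g \o cons true)) (IH (g \o cons false)).
move/(cx_ext (g := fun x => [:: g [seq nth false (e x) j | j <- i :: l]])).
move=> h; apply: cx_le (h _); last by move=> x /=; case: nth.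
by rewrite /= expnS; have := expn_gt0 2 (size l); lia.
Qed.

End Combinators.

Lemma blen_pair (A C : encType) : blen (A * C)%type = blen A + blen C.
Proof. by []. Qed.
Lemma blen_sum (A C : encType) : blen (A + C)%type = (maxn (blen A) (blen C)).+1.
Proof. by []. Qed.
Lemma blen_option (A : encType) : blen (option A) = (blen A).+1.
Proof. by []. Qed.
Lemma blen_ord k : blen 'I_k = up_log 2 k. Proof. by []. Qed.
Lemma blen_ffun n (A : encType) : blen {ffun 'I_n -> A} = n * blen A.
Proof. by []. Qed.
Lemma blen_mx m n (A : encType) : blen 'M[A]_(m, n) = m * n * blen A.
Proof. by []. Qed.
Lemma blen_tuple n (A : encType) : blen (n.-tuple A) = n * blen A.
Proof. by []. Qed.

Lemma bdec_benc (A : encType) (a : A) : bdec A (benc a) = Some a.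
Proof.
rewrite /bdec; case: pickP => [b /eqP/benc_inj-> //|/(_ a)].
by rewrite eqxx.
Qed.

Lemma flatten_bits (s : seq bool) w : size s = w ->
  flatten [seq [:: nth false s k] | k <- iota 0 w] = s.
Proof. by move<-; rewrite flatten_map1; exact: mkseq_nth. Qed.

Lemma benc_blocks_slice (I : eqType) (T : encType) (r : seq I) (f : I -> T) i :
  i \in r -> take (blen T) (drop (index i r * blen T) (benc_blocks r f)) = benc (f i).
Proof.
elim: r => //= j r IH; rewrite /benc_blocks /= -/(benc_blocks r f) inE [i == j]eq_sym.
case: eqVneq => [-> _|_] /=; first by rewrite mul0n drop0 -(size_benc (f i)) take_size_cat.
by move=> ri; rewrite mulSn -(size_benc (f j)) addnC -drop_drop drop_size_cat // size_benc IH.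
Qed.

(** * Circuits of size polynomial in a base bound *)

Section Efficient.
Variable B : nat.
Hypothesis B_ge : 16 <= B.

(* Sizes are powers of one base bound [B], a polynomial in [n], so that the
   exponents of all the circuits below are numerals that do not depend on [n]. *)
Definition eff (e : nat) (A C : encType) (f : A -> C) : Prop :=
  exists2 D, csize D <= B ^ e & computes D f.

(* The types in [llen] are small enough for truth tables. *)
Definition plen (e : nat) (A : encType) := blen A <= B ^ e.
Definition llen (e : nat) (A : encType) := 2 ^ blen A <= B ^ e.

Lemma plenE e A : plen e A = (blen A <= B ^ e). Proof. by []. Qed.
Lemma llenE e A : llen e A = (2 ^ blen A <= B ^ e). Proof. by []. Qed.

Lemma leBX x a b : x <= B ^ a -> a <= b -> x <= B ^ b.
Proof. by move=> h le_ab; rewrite (leq_trans h) // leq_pexp2l //; lia. Qed.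

Lemma BX_gt0 a : 0 < B ^ a. Proof. by rewrite expn_gt0; lia. Qed.

(** Constant factors are absorbed by one more power of [B]; this is what [B_ge] is for. *)
Lemma leB16 x a : x <= 16 * B ^ a -> x <= B ^ a.+1.
Proof. by move=> h; rewrite (leq_trans h) // expnS leq_mul2r B_ge orbT. Qed.

Lemma leBM x y a b : x <= B ^ a -> y <= B ^ b -> x * y <= B ^ (a + b).
Proof. by move=> *; rewrite expnD leq_mul. Qed.

Lemma llen_plen e A : llen e A -> plen e A.
Proof. by apply: leq_trans; apply/ltnW/ltn_expl. Qed.

Lemma llen_pair a b (A C : encType) : llen a A -> llen b C -> llen (a + b) (A * C)%type.
Proof. by move=> hA hC; rewrite llenE blen_pair expnD leBM. Qed.

Lemma plen_pair a b (A C : encType) : plen a A -> plen b C -> plen (maxn a b).+1 (A * C)%type.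
Proof.
move=> hA hC; apply: leB16; rewrite blen_pair.
have := leBX hA (leq_maxl a b); have := leBX hC (leq_maxr a b).
by have := BX_gt0 (maxn a b); lia.
Qed.

Lemma plen_sum a b (A C : encType) : plen a A -> plen b C -> plen (maxn a b).+1 (A + C)%type.
Proof.
move=> hA hC; apply: leB16; rewrite blen_sum.
have := leBX hA (leq_maxl a b); have := leBX hC (leq_maxr a b).
by have := BX_gt0 (maxn a b); lia.
Qed.

Lemma llen_option a (A : encType) : llen a A -> llen a.+1 (option A).
Proof.
move=> hA; apply: leB16; rewrite blen_option expnS.
by have := hA; rewrite /llen; lia.
Qed.

Lemma plen_option a (A : encType) : plen a A -> plen a.+1 (option A).
Proof.
move=> hA; apply: leB16; rewrite blen_option.
by have := hA; have := BX_gt0 a; rewrite /plen; lia.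
Qed.

Lemma llen_bool : llen 1 bool. Proof. by apply: leB16. Qed.

(** Rounding the number of elements up to a power of two at most doubles it. *)
Lemma llen_ord k e : 0 < k -> 2 * k <= B ^ e -> llen e 'I_k.
Proof.
move=> k_gt0 h; apply: leq_trans h; rewrite blen_ord.
case: k k_gt0 => [|[|k]] // _.
have /andP[] := @up_log_bounds 2 k.+2 isT isT.
by case: (up_log 2 k.+2) => [|u] /=; rewrite ?expnS; lia.
Qed.

Lemma eff_le a b (A C : encType) (f : A -> C) : eff a f -> a <= b -> eff b f.
Proof. by move=> [D hD eD] le_ab; exists D => //; apply: leBX le_ab. Qed.

Lemma eff_ext a (A C : encType) (f g : A -> C) : eff a f -> f =1 g -> eff a g.
Proof. by move=> [D hD eD] fg; exists D => // x; rewrite eD fg. Qed.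

Lemma eff_id a (A : encType) : plen a A -> eff a (@id A).
Proof. by move=> hA; apply: cx_le hA (cx_id (@size_benc A)). Qed.

Lemma eff_const a (A C : encType) (c : C) : plen a C -> eff a.+1 (fun _ : A => c).
Proof.
move=> hC; apply: cx_le (cx_const (@size_benc A) _).
by apply: leB16; have := hC; rewrite size_benc /plen; lia.
Qed.

Lemma eff_comp a b (A C D : encType) (f : A -> C) (g : C -> D) :
  eff a f -> eff b g -> eff (maxn a b).+1 (fun x => g (f x)).
Proof.
move=> hf [G leG eG].
have := cx_comp (@size_benc A) hf (g := fun x => benc (g (f x))) (t := B ^ b).
move=> h; apply: cx_le (h _); last by exists G => // x; apply: eG.
apply: leB16; have := leBX (leqnn (B ^ a)) (leq_maxl a b).
by have := leBX (leqnn (B ^ b)) (leq_maxr a b); have := BX_gt0 a; lia.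
Qed.

Lemma eff_pair a b (A C D : encType) (f : A -> C) (g : A -> D) :
  eff a f -> eff b g -> eff (maxn a b).+1 (fun x => (f x, g x)).
Proof.
move=> hf hg; apply: cx_le (cx_cat (@size_benc A) hf hg).
apply: leB16; have := leBX (leqnn (B ^ a)) (leq_maxl a b).
by have := leBX (leqnn (B ^ b)) (leq_maxr a b); have := BX_gt0 a; lia.
Qed.

Lemma eff_fst a (A C : encType) : plen a A -> eff a (fun p : A * C => p.1).
Proof.
move=> hA; have := @cx_slice _ _ _ (@size_benc (A * C)%type) 0 (blen A) (leq_addr _ _).
move/(cx_le hA)/cx_ext; apply=> x.
by rewrite drop0 [benc x]/= /benc_pair -(size_benc x.1) take_size_cat.
Qed.

Lemma eff_snd a (A C : encType) : plen a C -> eff a (fun p : A * C => p.2).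
Proof.
move=> hA; have := @cx_slice _ _ _ (@size_benc (A * C)%type) (blen A) (blen C) (leqnn _).
move/(cx_le hA)/cx_ext; apply=> x.
rewrite [benc x]/= /benc_pair -(size_benc x.1) drop_size_cat //.
by rewrite -(size_benc x.2) take_size.
Qed.

(** There is one truth table per output bit, and each has size linear in [2 ^ blen A]. *)
Lemma eff_table a b (A C : encType) (f : A -> C) : llen a A -> plen b C -> eff (a + b).+1 f.
Proof.
move=> hA hC.
pose g k s := if bdec A s is Some x then nth false (benc (f x)) k else false.
have /cx_flatten h : {in iota 0 (blen C), forall k, cx (fun x : A => benc x)
    (fun x => [:: g k [seq nth false (benc x) i | i <- iota 0 (blen A)]])
    (14 * 2 ^ blen A - 12)}.
  move=> k _; apply: cx_le (cx_table (@size_benc A) _ (g k)).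
  by rewrite size_iota.
apply: cx_le (cx_ext _ (h _ (@size_benc A))).
  rewrite size_iota addnC -addnS; apply: leBM => //; apply: leB16.
  by have := hA; rewrite /llen; have := expn_gt0 2 (blen A); lia.
move=> x /=; rewrite -(flatten_bits (size_benc (f x))).
congr flatten; apply: eq_map => k; congr [:: _].
rewrite /g; suff -> : [seq nth false (benc x) i | i <- iota 0 (blen A)] = benc x.
  by rewrite bdec_benc.
by rewrite -(size_benc x); exact: mkseq_nth.
Qed.

Lemma eff_map2 a b c (A C D G : encType) (f : A -> C) (g : A -> D) (op : C -> D -> G) :
  eff c (fun p : C * D => op p.1 p.2) -> eff a f -> eff b g ->
  eff (maxn (maxn a b).+1 c).+1 (fun x => op (f x) (g x)).
Proof. by move=> hop hf hg; apply: (eff_comp (eff_pair hf hg) hop). Qed.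

Lemma eff_bit (A : encType) k : eff 0 (fun x : A => nth false (benc x) k).
Proof.
by apply: cx_le (cx_ext _ (cx_proj (fun x : A => benc x) [:: k])).
Qed.

Lemma eff_flatten (I : eqType) (r : seq I) a d (A C : encType) (f : A -> C)
    (F : I -> A -> seq bool) :
  {in r, forall i, cx (fun x => benc x) (F i) (B ^ a)} -> size r <= B ^ d ->
  (forall x, flatten [seq F i x | i <- r] = benc (f x)) -> eff (d + a).+1 f.
Proof.
move=> hF le_r fE; apply: cx_le (cx_ext fE (cx_flatten (@size_benc A) hF)).
rewrite -addnS leBM //; apply: leB16; have := BX_gt0 a; lia.
Qed.

Lemma eff_if a b c l (A C : encType) (t : A -> bool) (f g : A -> C) :
  plen l C -> eff a t -> eff b f -> eff c g ->
  eff (maxn (maxn a (maxn b c).+1).+1 l.+2).+1 (fun x => if t x then f x else g x).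
Proof.
move=> hC ht hf hg.
(* Bits are selected one at a time. The test is input wire 0; bit [k] of the two branches is on
   wires [k + 1] and [k + blen C + 1]. *)
have hmux : eff l.+2 (fun p : bool * (C * C) => if p.1 then p.2.1 else p.2.2).
  have hb k : k < blen C -> cx (fun p : bool * (C * C) => benc p)
    (fun p => [:: nth false (benc (if p.1 then p.2.1 else p.2.2)) k]) (B ^ 1).
    move=> ltk; have szp := @size_benc (bool * (C * C))%type.
    have := cx_if1 szp (cx_proj (fun p : bool * (C * C) => benc p) [:: 0])
      (cx_proj _ [:: k.+1]) (cx_proj _ [:: (k + blen C).+1]).
    move/(cx_ext (g := fun p : bool * (C * C) =>
      [:: nth false (benc (if p.1 then p.2.1 else p.2.2)) k])) => h.
    apply: cx_le (h _); first by rewrite /=; lia.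
    case=> b0 [u v] /=; rewrite /benc_pair /=; congr [:: _].
    case: b0; rewrite nth_cat size_benc; first by rewrite ltk.
    by rewrite ltnNge leq_addl addnK.
  apply: eff_le (eff_flatten (d := l) (r := iota 0 (blen C)) (a := 1)
     (F := fun k p => [:: nth false (benc (if p.1 then p.2.1 else p.2.2)) k]) _ _ _) _.
  - by move=> k; rewrite mem_iota add0n; apply: hb.
  - by rewrite size_iota.
  - by move=> x; rewrite flatten_bits // size_benc.
  - by rewrite addn1.
exact: (eff_comp (eff_pair ht (eff_pair hf hg)) hmux).
Qed.

Lemma eff_ffun a d n (A C : encType) (F : 'I_n -> A -> C) :
  (forall i, eff a (F i)) -> n <= B ^ d -> eff (d + a).+1 (fun x => [ffun i => F i x]).
Proof.
move=> hF le_n; apply: (eff_flatten (r := enum 'I_n) (F := fun i x => benc (F i x))).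
- by move=> i _; apply: hF.
- by rewrite size_enum_ord.
move=> x; congr flatten; apply: eq_map => i; congr benc; by rewrite ffunE.
Qed.

Lemma eff_tuple a d n (A C : encType) (F : 'I_n -> A -> C) :
  (forall i, eff a (F i)) -> n <= B ^ d -> eff (d + a).+1 (fun x => [tuple F i x | i < n]).
Proof.
move=> hF le_n; apply: (eff_flatten (r := enum 'I_n) (F := fun i x => benc (F i x))).
- by move=> i _; apply: hF.
- by rewrite size_enum_ord.
move=> x; congr flatten; apply: eq_map => i; congr benc; by rewrite tnth_mktuple.
Qed.

Lemma eff_mx a d m n (A C : encType) (F : 'I_m -> 'I_n -> A -> C) :
  (forall i j, eff a (F i j)) -> m * n <= B ^ d ->
  eff (d + a).+1 (fun x => \matrix_(i, j) F i j x)%R.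
Proof.
move=> hF le_n; apply: (eff_flatten (r := enum {: 'I_m * 'I_n})
  (F := fun ij x => benc (F ij.1 ij.2 x))).
- by move=> i _; apply: hF.
- by rewrite -cardE card_prod !card_ord.
move=> x; congr flatten; apply: eq_map => i; congr benc; by rewrite mxE.
Qed.

Lemma eff_block (I : eqType) (r : seq I) a (A C : encType) (f : A -> I -> C) i :
  (forall x, benc x = benc_blocks r (f x)) -> blen A = size r * blen C ->
  i \in r -> plen a C -> eff a (fun x => f x i).
Proof.
move=> encE szE ri hC.
have : index i r * blen C + blen C <= blen A.
  by rewrite szE -mulSnr leq_mul2r index_mem ri orbT.
move/(cx_slice (@size_benc A))/(cx_le hC)/cx_ext; apply => x.
by rewrite encE benc_blocks_slice.
Qed.

Lemma eff_mx_proj a m n (C : encType) i j : plen a C ->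
  eff a (fun M : 'M[C]_(m, n) => M i j).
Proof.
apply: (@eff_block _ (enum {: 'I_m * 'I_n}) a 'M[C]_(m, n) C (fun M ij => M ij.1 ij.2) (i, j)) => //.
  by rewrite blen_mx -cardE card_prod !card_ord.
by rewrite mem_enum.
Qed.

(** The induction adds up raw sizes and passes to powers of [B] only at the end: iterating
    [eff_comp] would raise the exponent at every term. The same holds for [eff_foldl]. *)
Lemma eff_big a b c d (I : eqType) (r : seq I) (A C : encType)
    (op : C -> C -> C) idx (F : I -> A -> C) :
  eff a (fun p : C * C => op p.1 p.2) -> plen b C ->
  {in r, forall i, eff c (F i)} -> size r <= B ^ d ->
  eff (maxn b (d + (maxn a c).+1)).+1 (fun x => \big[op/idx]_(i <- r) F i x).
Proof.
move=> hop hC hF le_r.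
have h : cx (fun x : A => benc x) (fun x => benc (\big[op/idx]_(i <- r) F i x))
    (2 * B ^ b + size r * (B ^ c + B ^ a + 2)).
  elim: r hF {le_r} => [|i r IH] hF.
    apply: cx_le (cx_ext _ (cx_const (@size_benc A) (benc idx))).
      by rewrite size_benc; move: hC; rewrite /plen; lia.
    by move=> x; rewrite big_nil.
  have {}IH := IH (fun j rj => hF j (mem_behead (s := i :: r) rj)).
  have hp := cx_cat (@size_benc A) (hF i (mem_head _ _)) IH.
  have [G leG eG] := hop.
  have hx := cx_comp (@size_benc A) (e' := fun p : C * C => benc p)
    (u := fun x => (F i x, \big[op/idx]_(j <- r) F j x)) hp.
  apply: cx_le (hx (fun x => benc (\big[op/idx]_(j <- i :: r) F j x)) (B ^ a) _).
    by rewrite /= mulSn; lia.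
  by exists G => // x; rewrite eG big_cons.
apply: cx_le h; apply: leB16.
apply: (@leq_trans (2 * B ^ (maxn b (d + (maxn a c).+1))
                    + B ^ (maxn b (d + (maxn a c).+1)))); last by lia.
apply: leq_add; first by rewrite leq_mul2l (leBX (leqnn _) (leq_maxl _ _)) orbT.
apply: leBX (leq_maxr _ _); apply: leBM => //; apply: leB16.
have := leBX (leqnn (B ^ a)) (leq_maxl a c).
by have := leBX (leqnn (B ^ c)) (leq_maxr a c); have := BX_gt0 a; lia.
Qed.

Lemma eff_foldl a b d (I : Type) (A C : encType) (next : I -> C -> C)
    (f : A -> C) (r : seq I) :
  (forall i, eff a (next i)) -> eff b f -> size r <= B ^ d ->
  eff (maxn b (d + a.+1)).+1 (fun x => foldl (fun c i => next i c) (f x) r).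
Proof.
move=> hnext hf le_r.
have h : cx (fun x : A => benc x) (fun x => benc (foldl (fun c i => next i c) (f x) r))
    (B ^ b + size r * (B ^ a + 1)).
  elim/last_ind: r {le_r} => [|r i IH]; first by rewrite addn0.
  have [G leG eG] := hnext i.
  have hx := cx_comp (@size_benc A) (e' := fun c : C => benc c)
    (u := fun x => foldl (fun c i => next i c) (f x) r) IH.
  apply: cx_le (hx (fun x => benc (foldl (fun c i => next i c) (f x) (rcons r i))) (B ^ a) _).
    by rewrite size_rcons mulSn; lia.
  by exists G => // x; rewrite eG foldl_rcons.
apply: cx_le h; apply: leB16.
apply: (@leq_trans (B ^ (maxn b (d + a.+1)) + B ^ (maxn b (d + a.+1)))); last by lia.
apply: leq_add; first exact: leBX (leqnn _) (leq_maxl _ _).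
apply: leBX (leq_maxr _ _); apply: leBM => //; apply: leB16.
by have := BX_gt0 a; lia.
Qed.

Lemma eff_andb : eff 3 (fun p : bool * bool => p.1 && p.2).
Proof. exact: (eff_table _ (llen_pair llen_bool llen_bool) (b := 0)). Qed.

Lemma eff_eq a (C : encType) : plen a C ->
  eff (a + 6).+1 (fun p : C * C => p.1 == p.2).
Proof.
move=> hC.
have h : eff (a + 6).+1 (fun p : C * C =>
    \big[andb/true]_(k <- iota 0 (blen C)) (nth false (benc p.1) k == nth false (benc p.2) k)).
  apply: eff_le (eff_big (b := 0) (c := 4) (d := a) (a := 3) true _ _ _ _) _.
  - exact: eff_andb.
  - by rewrite /plen.
  - move=> k; rewrite mem_iota add0n => /= ltk.
    apply: eff_le (eff_map2 (a := 0) (b := 0) (c := 3) (op := fun x y : bool => x == y) _ _ _) _.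
    + exact: (eff_table _ (llen_pair llen_bool llen_bool) (b := 0)).
    + apply: eff_ext (eff_bit _ k) _ => p.
      by rewrite /= /benc_pair nth_cat size_benc ltk.
    + apply: eff_ext (eff_bit _ (k + blen C)) _ => p.
      by rewrite /= /benc_pair nth_cat size_benc ltnNge leq_addl addnK.
    + by [].
  - by rewrite size_iota.
  - by rewrite max0n; lia.
apply: eff_ext h _ => -[x y] /=; rewrite big_all; apply/allP/eqP => [h|-> //].
apply: benc_inj; apply: (@eq_from_nth _ false); first by rewrite !size_benc.
by move=> k ltk; apply/eqP/h; rewrite mem_iota /= -(size_benc x).
Qed.

(** Sums and [Some] share this shape: a tag bit, the payload and zero padding. *)
Lemma eff_pad a b w (h : bool) (A C D : encType) (f : A -> C) (g : A -> D) :
  eff a f -> w <= B ^ b -> (forall x, benc (g x) = h :: benc (f x) ++ nseq w false) ->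
  eff (maxn a b).+1 g.
Proof.
move=> hf le_w gE.
have := cx_cat (@size_benc A) (cx_const (@size_benc A) [:: h])
  (cx_cat (@size_benc A) hf (cx_const (@size_benc A) (nseq w false))).
move/(cx_ext (g := fun x => benc (g x))) => hg.
apply: cx_le (hg (fun x => esym (gE x))); apply: leB16; rewrite size_nseq.
have := leBX (leqnn (B ^ a)) (leq_maxl a b).
by have := leBX le_w (leq_maxr a b); have := BX_gt0 a; rewrite /=; lia.
Qed.

Lemma eff_inl a b (A C D : encType) (f : A -> C) :
  plen b D -> eff a f -> eff (maxn a b).+1 (fun x => inl D (f x)).
Proof.
move=> hD hf; apply: (eff_pad (h := true) (w := maxn (blen C) (blen D) - blen C) hf) => //.
by rewrite (leq_trans _ hD) //; lia.
Qed.

Lemma eff_inr a b (A C D : encType) (f : A -> D) :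
  plen b C -> eff a f -> eff (maxn a b).+1 (fun x => inr C (f x)).
Proof.
move=> hC hf; apply: (eff_pad (h := false) (w := maxn (blen C) (blen D) - blen D) hf) => //.
by rewrite (leq_trans _ hC) //; lia.
Qed.

Lemma eff_Some a (A C : encType) (f : A -> C) :
  eff a f -> eff a.+1 (fun x => Some (f x)).
Proof.
move=> hf; rewrite -[a](maxn0); apply: (eff_pad (w := 0) hf) => // x.
by rewrite cats0.
Qed.

End Efficient.

(** * The game with fixed coins *)

Lemma mulrz_mxE (V : zmodType) a b (M : 'M[V]_(a, b)) (z : int) i j :
  ((M *~ z) i j = M i j *~ z)%R.
Proof. by case: z => p; rewrite ?NegzE ?mulrNz ?mxE -!pmulrn mulmxnE. Qed.

Lemma benc_bits n (t : n.-tuple bool) : benc t = t :> seq bool.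
Proof.
transitivity (flatten [seq [:: tnth t i] | i <- enum 'I_n]) => //.
by rewrite flatten_map1 map_tnth_enum.
Qed.

Lemma bound_base e : e <= e + 0. Proof. by rewrite addn0. Qed.
Lemma bound_0 e : 0 <= e + 0. Proof. by []. Qed.
Lemma bound_S e x c : x <= e + c -> x.+1 <= e + c.+1.
Proof. by rewrite addnS. Qed.
Lemma bound_add e x c d : x <= e + c -> x + d <= e + (c + d).
Proof. by rewrite addnA leq_add2r. Qed.
Lemma bound_addl e x c d : x <= e + c -> d + x <= e + (c + d).
Proof. by lia. Qed.
Lemma bound_max e x y c d : x <= e + c -> y <= e + d -> maxn x y <= e + maxn c d.
Proof. by lia. Qed.

Ltac bound :=
  lazymatch goal with
  | |- is_true (maxn _ _ <= _) => apply: bound_max; bound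
  | |- is_true (S _ + _ <= _) => apply: bound_addl; bound
  | |- is_true (_ + _ <= _) => apply: bound_add; bound
  | |- is_true (_.+1 <= _) => apply: bound_S; bound
  | |- is_true (0 <= _) => exact: bound_0
  | _ => exact: bound_base
  end.

(* Bounds a nested maximum by its only variable plus a numeral; [lia] alone is
   exponential in the number of maxima. *)
Ltac max_le := eapply leq_trans; [bound | rewrite leq_add2l; exact: isT].

(** The ciphertexts that a distinguisher assembles from its challenge [a]: real encryptions under
    the challenge key before position [i], the challenge ciphertext at [i], and hardwired ideal
    samples after it. *)
Definition mix_at (F : fhe) lam l (b : l.-tuple bool) (i : 'I_l)
    (rs : {ffun 'I_l -> (enc_coins F lam).-tuple bool}) (cs : {ffun 'I_l -> ct_t F lam})
    (a : pk_t F lam * ct_t F lam) : {ffun 'I_l -> ct_t F lam} :=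
  [ffun j : 'I_l => if j < i then fhe_enc a.1 (tnth b j) (rs j)
                    else if j == i then a.2 else cs j].

Section Game.
Variables (F : fhe) (n N k lam : nat) (A0 : det_stream_alg n N) (adv : adversary).
Variable m : 'I_n.

Notation S0 := (sa_state F lam A0).
Definition event_t : encType :=
  (hash_key F n lam + (unit + unit * option (vec_t n N)))%type.
Definition mem_t : encType := ((adv_mem adv).-tuple bool : Type).
Definition game_state : encType := (mem_t * S0 * event_t * vec_t n N)%type.
Notation St := game_state.

(** The shift by [N] inverts [bval]. The result is meaningful only for vectors in range. *)
Definition vec_of (x : 'rV[int]_n) : vec_t n N :=
  (map_mx (fun z : int => inord (absz (z + N%:Z)%R)) x)%R.

Definition adv_out (w : (adv_coins adv).-tuple bool) (st : St) : seq bool :=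
  ceval (adv_step adv) (st.1.1.1 ++ benc st.1.1.2 ++ benc st.1.2 ++ w).

Definition adv_act w (st : St) : option (option (upd_t n N)) :=
  bdec (option (upd_t n N)) (drop (adv_mem adv) (adv_out w st)).

(** Padded to a fixed length so that it is encodable; after a valid action it agrees with the memory
    of the real game, by [take_adv_out]. *)
Definition adv_mem' w (st : St) : mem_t :=
  [tuple nth false (adv_out w st) i | i < adv_mem adv].

(* Unlike in the real game, an invalid action leaves the state unchanged, and
   the length of the stream is not bounded. *)
Definition game_next w (st : St) : St :=
  match adv_act w st with
  | None => st
  | Some None => (adv_mem' w st, st.1.1.2, inr (inr (tt, sa_report k st.1.1.2 tt)), st.2)
  | Some (Some u) =>
      if in_range N (apply_upd (vval st.2) u) then
        (adv_mem' w st, sa_update st.1.1.2 u tt, inr (inl tt),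
         vec_of (apply_upd (vval st.2) u))
      else st
  end.

(** The true vector is part of the simulated state, so a wrong entry can be recognized. A wrong bot
    is not recorded because it cannot occur in a reached state, by [incorrect_bad]. *)
Definition bad w (st : St) : bool :=
  (adv_act w st == Some None) &&
  (if sa_report k st.1.1.2 tt is Some x' then x' ord0 m != st.2 ord0 m else false).

Definition next_bad w (sb : St * bool) : St * bool :=
  (game_next w sb.1, sb.2 || bad w sb.1).

Definition start (h : hash_key F n lam) : St :=
  (nseq_tuple (adv_mem adv) false, sa_setup A0 h, inl h, vec_of 0%R).

Definition game (h : hash_key F n lam) (ws : seq ((adv_coins adv).-tuple bool)) : bool :=
  (foldl (fun sb w => next_bad w sb) (start h, false) ws).2.

(** * Circuit size of the game *)

Section Circuit.
Variable B : nat.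
Hypotheses (B_ge : 16 <= B) (n_B : 2 * n.+2 <= B) (N_B : 2 * N.*2.*2.+1 <= B).
Hypotheses (q_B : 2 * modulus F lam <= B) (dim_B : ctdim F lam <= B).
Hypotheses (pk_B : plen B 1 (pk_t F lam)) (st_B : plen B 1 (det_state A0)).
Hypotheses (mem_B : adv_mem adv <= B) (coins_B : adv_coins adv <= B).
Hypothesis step_B : csize (adv_step adv) <= B.
Hypothesis upd_B : eff B 1 (fun a : det_state A0 * upd_t n N => det_update a.1 a.2).
Hypothesis rep_B : eff B 1 (fun s : det_state A0 => det_report s).
Hypothesis ct_B : forall i : 'I_n, eff B 1 (fun h : hash_key F n lam => index_ct h i).

Local Notation q := (modulus F lam).
Local Notation eff := (eff B).
Local Notation plen := (plen B).
Local Notation llen := (llen B).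

Lemma n_gt0 : 0 < n. Proof. by case: m => i; apply: leq_trans. Qed.
Lemma n_le1 : n <= B ^ 1. Proof. by rewrite expn1; lia. Qed.

Lemma llen_Zq : llen 1 'Z_q.
Proof. by apply: llen_ord => //; rewrite expn1 Zp_cast ?modulus_gt1. Qed.
Lemma plen_Zq : plen 1 'Z_q. Proof. exact: (llen_plen llen_Zq). Qed.
Lemma llen_n : llen 1 'I_n.
Proof. by apply: llen_ord; rewrite ?n_gt0 ?expn1; lia. Qed.
Lemma llen_n2 : llen 1 'I_n.+2.
Proof. by apply: llen_ord => //; rewrite expn1. Qed.
Lemma llen_N : llen 1 'I_N.*2.+1.
Proof. by apply: llen_ord => //; rewrite expn1; lia. Qed.
Lemma llen_4N : llen 1 'I_N.*2.*2.+1.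
Proof. by apply: llen_ord => //; rewrite expn1; lia. Qed.
Lemma llen_upd : llen 2 (upd_t n N). Proof. exact: llen_pair llen_n llen_4N. Qed.
Lemma llen_act : llen 4 (option (option (upd_t n N))).
Proof. exact/(llen_option B_ge)/(llen_option B_ge)/llen_upd. Qed.

Lemma plen_ct : plen 2 (ct_t F lam).
Proof.
rewrite plenE blen_mx mul1n -[2]/(1 + 1); apply: leBM; rewrite ?expn1 //.
by rewrite -[B]expn1; exact: (llen_plen llen_Zq).
Qed.
Lemma plen_vec : plen 2 (vec_t n N).
Proof.
rewrite plenE blen_mx mul1n -[2]/(1 + 1); apply: leBM n_le1 _.
exact: (llen_plen llen_N).
Qed.
Lemma plen_cts : plen 3 {ffun 'I_(index_len n) -> ct_t F lam}.
Proof.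
rewrite plenE blen_ffun -[3]/(1 + 2); apply: leBM plen_ct.
rewrite expn1; apply: leq_trans (_ : n <= B); last by lia.
by apply: up_log_min => //; exact/ltnW/ltn_expl.
Qed.
Lemma plen_key : plen 4 (hash_key F n lam).
Proof. exact: (plen_pair B_ge pk_B plen_cts). Qed.
Lemma plen_S0 : plen 6 S0.
Proof. exact: (plen_pair B_ge (plen_pair B_ge st_B plen_key) plen_ct). Qed.
Lemma plen_unit e : plen e unit. Proof. by []. Qed.
Lemma plen_ans : plen 3 (option (vec_t n N)). Proof. exact: plen_option B_ge _ _ plen_vec. Qed.
Lemma plen_ev2 : plen 5 (unit + unit * option (vec_t n N))%type.
Proof. exact: (plen_sum B_ge (plen_unit 0) (plen_pair B_ge (plen_unit 0) plen_ans)). Qed.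
Lemma plen_event : plen 6 event_t.
Proof. exact: (plen_sum B_ge plen_key plen_ev2). Qed.
Lemma plen_mem : plen 1 mem_t.
Proof. by rewrite plenE blen_tuple muln1 expn1. Qed.
Lemma plen_St1 : plen 8 (mem_t * S0 * event_t)%type.
Proof. exact: (plen_pair B_ge (plen_pair B_ge plen_mem plen_S0) plen_event). Qed.
Lemma plen_St : plen 9 St.
Proof. exact: (plen_pair B_ge plen_St1 plen_vec). Qed.

Lemma eff_s : eff 10 (fun st : St => st.1.1.2).
Proof.
have h1 := eff_fst (vec_t n N) plen_St1.
have h2 := eff_fst (event_t) (plen_pair B_ge plen_mem plen_S0).
have h3 := eff_snd (mem_t) plen_S0.
exact: (eff_le B_ge (eff_comp B_ge h1 (eff_comp B_ge h2 h3)) _).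
Qed.

(** The coins [w] are appended as constants, and [benc st.1] is the rest of what the circuit of the
    adversary reads. Single bits are used because the length of its output is not controlled. *)
Lemma eff_out w j : eff 9 (fun st : St => nth false (adv_out w st) j).
Proof.
have h1 := cx_cat (@size_benc St) (eff_fst _ plen_St1 : eff _ (fun st : St => st.1))
  (cx_const (@size_benc St) w).
have h2 := cx_comp (@size_benc St) (e' := id)
   (u := fun st : St => benc st.1 ++ w) h1 (g := adv_out w) (t := B).
have {}h2 := h2 _; apply: cx_le (cx_bit (@size_benc St) j (h2 _) _); first last.
- by rewrite addn1.
- exists (adv_step adv) => // -[[[mm s] e] x]; rewrite /adv_out.
  by rewrite [benc _]/((benc mm ++ benc s) ++ benc e) benc_bits -!catA.
rewrite size_tuple; have : B <= B ^ 8 by rewrite -{1}[B]expn1 leq_pexp2l //; lia.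
by rewrite (expnS _ 8); nia.
Qed.

Lemma eff_mem' w : eff 11 (adv_mem' w).
Proof.
apply: (eff_tuple B_ge (d := 1) (a := 9)); last by rewrite expn1.
by move=> i; apply: eff_out.
Qed.

Lemma eff_act w : eff 16 (adv_act w).
Proof.
pose K := blen (option (upd_t n N)).
pose rest st := [tuple nth false (adv_out w st) (adv_mem adv + i) | i < K].
have llenK : llen 3 (K.-tuple bool : Type).
  by rewrite llenE blen_tuple muln1; exact: (llen_option B_ge llen_upd).
have h_rest : eff 13 rest.
  apply: (eff_tuple B_ge (d := 3)); last exact: leq_trans (ltnW (ltn_expl _ _)) (llen_option B_ge llen_upd).
  by move=> i; apply: eff_out.
have sz_out st : size (adv_out w st) = size (outs (adv_step adv)) by rewrite size_map.
(* The output length is fixed by the circuit. If it is right, the action is decoded by a truth table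
   on [K] bits; otherwise decoding always fails and the action is constant. *)
case: (eqVneq (size (outs (adv_step adv))) (adv_mem adv + K)) => [eqK|neqK].
  have hdec := eff_table B_ge (fun s : K.-tuple bool => bdec (option (upd_t n N)) s) llenK
     (llen_plen llen_act).
  apply: (eff_le B_ge) (eff_ext (eff_comp B_ge h_rest hdec) _) _ => // st.
  rewrite /adv_act; congr bdec; apply: (@eq_from_nth _ false).
    by rewrite size_tuple size_drop sz_out eqK addKn.
  move=> i; rewrite size_tuple => lti; rewrite nth_drop.
  by rewrite (nth_mktuple _ _ (Ordinal lti)).
apply: (eff_le B_ge) (eff_ext (eff_const B_ge _ (None : option (option (upd_t n N))) (llen_plen llen_act)) _) _ => // st.
rewrite /adv_act /bdec; case: pickP => // a /eqP/(congr1 size).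
rewrite size_benc size_drop sz_out -/K => eqK.
(* Positivity of [K] rules out that the truncated subtraction hides a wrong length. *)
have : 0 < K by [].
by move/eqP: neqK; lia.
Qed.

Lemma eff_addct : eff 10 (fun p : ct_t F lam * ct_t F lam => p.1 + p.2)%R.
Proof.
have h (i : 'I_1) j : eff 5 (fun p : ct_t F lam * ct_t F lam => p.1 i j + p.2 i j)%R.
  have h1 := eff_comp B_ge (eff_fst (ct_t F lam) plen_ct) (eff_mx_proj i j plen_Zq).
  have h2 := eff_comp B_ge (eff_snd (ct_t F lam) plen_ct) (eff_mx_proj i j plen_Zq).
  have h3 := eff_table B_ge (fun p : 'Z_q * 'Z_q => p.1 + p.2)%R (llen_pair llen_Zq llen_Zq) plen_Zq.
  exact: (eff_le B_ge (eff_map2 B_ge (op := fun a b : 'Z_q => (a + b)%R) h3 h1 h2) _).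
apply: (eff_le B_ge) (eff_ext (eff_mx B_ge (d := 1) h _) _) _ => //.
  by rewrite mul1n expn1.
by move=> p; apply/matrixP=> i j; rewrite !mxE.
Qed.

Lemma big_enum_ord (V : nmodType) (G : 'I_n -> V) :
  (\sum_(i < n) G i = \sum_(i <- enum 'I_n) G i)%R.
Proof. by rewrite big_enum. Qed.

Lemma eff_sum_ct a (A : encType) (G : 'I_n -> A -> ct_t F lam) :
  (forall i, eff a (G i)) -> eff (maxn 10 a + 3) (fun x => \sum_(i < n) G i x)%R.
Proof.
move=> hG.
have := eff_big B_ge (d := 1) (r := enum 'I_n)
  (op := fun u v : ct_t F lam => (u + v)%R) (0%R : ct_t F lam) eff_addct plen_ct (fun i _ => hG i).
rewrite size_enum_ord => /(_ n_le1) h.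
apply: (eff_le B_ge) (eff_ext h _) _ => [x|]; first by rewrite big_enum_ord.
by rewrite maxnC; lia.
Qed.

(** An arbitrary [op] covers both multiplication by an entry, in [eff_hash], and the conditional
    contribution of an update, in [eff_update]. *)
Lemma eff_scale (C : encType) a b c (A : encType) (z : A -> ct_t F lam) (y : A -> C)
    (op : 'Z_q -> C -> 'Z_q) :
  llen c C -> eff a z -> eff b y ->
  eff (maxn (maxn a.+1 2 ).+1 (maxn b (c + 2)) + 5) (fun x => map_mx (fun t => op t (y x)) (z x)).
Proof.
move=> hC hz hy.
have h (i : 'I_1) (j : 'I_(ctdim F lam)) :
    eff (maxn (maxn a.+1 2).+1 (maxn b (c + 2)) + 3) (fun x => op (z x i j) (y x)).
  have h1 := eff_comp B_ge hz (eff_mx_proj i j plen_Zq).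
  have h3 := eff_table B_ge (fun p : 'Z_q * C => op p.1 p.2)%R (llen_pair llen_Zq hC) plen_Zq.
  apply: (eff_le B_ge) (eff_map2 B_ge (op := op) h3 h1 hy) _.
  by lia.
apply: (eff_le B_ge) (eff_ext (eff_mx B_ge (d := 1) h _) _) _.
- by rewrite mul1n expn1.
- by move=> x; apply/matrixP=> i j; rewrite !mxE.
by lia.
Qed.

(** A count of at most [n] does not wrap modulo [n + 2], and such a counter is short enough for
    truth tables. *)
Lemma norm0_val (x : 'rV[int]_n) :
  norm0 x = (\sum_(i < n) (x ord0 i != 0)%:R : 'I_n.+2)%R.
Proof.
rewrite -natr_sum -big_mkcond sum1dep_card Zp_nat /= modn_small //.
rewrite ltnS leqW // -[X in _ <= X]card_ord; exact: max_card.
Qed.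

Lemma eff_entry (j : 'I_n) : eff 1 (fun x : vec_t n N => x ord0 j).
Proof. exact: eff_mx_proj (llen_plen llen_N). Qed.

Lemma eff_norm : eff 9 (fun x : vec_t n N => k < norm0 (vval x)).
Proof.
have h1 (i : 'I_n) : eff 4 (fun x : vec_t n N => (vval x ord0 i != 0)%:R : 'I_n.+2)%R.
  have ht := eff_table B_ge (fun z : 'I_N.*2.+1 => (bval z != 0)%:R : 'I_n.+2)%R llen_N (llen_plen llen_n2).
  by apply: eff_ext (eff_comp B_ge (eff_entry i) ht) _ => x; rewrite mxE.
have hop := eff_table B_ge (fun p : 'I_n.+2 * 'I_n.+2 => p.1 + p.2)%R (llen_pair llen_n2 llen_n2) (llen_plen llen_n2).
have := eff_big B_ge (d := 1) (r := enum 'I_n)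
  (op := fun u v : 'I_n.+2 => (u + v)%R) (0%R : 'I_n.+2) hop (llen_plen llen_n2) (fun i _ => h1 i).
rewrite size_enum_ord => /(_ n_le1) h.
have hk := eff_table B_ge (fun z : 'I_n.+2 => k < z) llen_n2 (llen_plen (llen_bool B_ge)).
apply: (eff_le B_ge) (eff_ext (eff_comp B_ge h hk) _) _ => // x.
by rewrite norm0_val big_enum_ord.
Qed.

Definition hash (h : hash_key F n lam) (x : vec_t n N) : ct_t F lam :=
  (\sum_(i < n) index_ct h i *~ vval x ord0 i)%R.

Lemma eff_hash (A : encType) a b (h : A -> hash_key F n lam) (x : A -> vec_t n N) :
  eff a h -> eff b x ->
  eff (maxn 10 (maxn a b + 20)) (fun y => hash (h y) (x y)).
Proof.
move=> hh hx.
have h1 (i : 'I_n) : eff (maxn a b + 15) (fun y => index_ct (h y) i *~ vval (x y) ord0 i)%R.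
  have h2 := eff_comp B_ge hh (ct_B i).
  have h3 := eff_comp B_ge hx (eff_entry i).
  apply: (eff_le B_ge) (eff_ext (eff_scale (fun t z => t *~ bval z)%R llen_N h2 h3) _) _.
    by move=> y; apply/matrixP=> u v; rewrite mulrz_mxE !mxE.
  by lia.
by apply: (eff_le B_ge) (eff_sum_ct h1) _; lia.
Qed.

Lemma eff_report : eff 40 (fun s : S0 => sa_report k s tt).
Proof.
have h1 : eff 5 (fun s : S0 => s.1) := eff_fst _ (plen_pair B_ge st_B plen_key).
have hs := eff_comp B_ge h1 (eff_fst _ st_B).
have hh := eff_comp B_ge h1 (eff_snd _ plen_key).
have hx := eff_comp B_ge hs rep_B.
have hn := eff_comp B_ge hx eff_norm.
have hha := eff_hash hh hx.
have heq := eff_map2 B_ge (eff_eq B_ge plen_ct) hha (eff_snd _ plen_ct).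
have hsome := eff_Some B_ge hx.
have hnone : eff 4 (fun s : S0 => None : option (vec_t n N)) := eff_const B_ge _ _ plen_ans.
have h2 := eff_if B_ge plen_ans heq hsome hnone.
have h3 := eff_if B_ge plen_ans hn hnone h2.
by apply: (eff_le B_ge) (eff_ext h3 _) _ => // -[[s h] sk].
Qed.

Lemma eff_update (A : encType) a (s : A -> S0) (u : A -> upd_t n N) :
  eff a s -> eff a u -> eff (a + 50) (fun y => sa_update (s y) (u y) tt).
Proof.
move=> hs hu.
have h1 : eff 5 (fun s : S0 => s.1) := eff_fst _ (plen_pair B_ge st_B plen_key).
have hs1 := eff_comp B_ge hs h1.
have hsk := eff_comp B_ge hs (eff_snd _ plen_ct).
have hd := eff_comp B_ge hs1 (eff_fst _ st_B).
have hh := eff_comp B_ge hs1 (eff_snd _ plen_key).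
have hd' := eff_map2 B_ge upd_B hd hu.
(* The updated index is data, while [ct_B] gives a circuit for each fixed index only. So all
   evaluated ciphertexts are summed, with those at other indices replaced by zero. *)
have hi (i : 'I_n) := eff_scale
  (fun t z => if z.1 == i then t *~ bval z.2 else 0)%R llen_upd (eff_comp B_ge hh (ct_B i)) hu.
have hsk' := eff_map2 B_ge eff_addct hsk (eff_sum_ct hi).
have := eff_pair B_ge (eff_pair B_ge hd' hh) hsk'.
move/(eff_ext (g := fun y => sa_update (s y) (u y) tt)) => h.
apply: (eff_le B_ge) (h _) _; last by max_le.
move=> y; case: (s y) => -[s0 h0] sk /=; congr (_, _, (_ + _)%R).
rewrite (bigD1 (u y).1) //= big1 => [|i /negPf neq].
  by rewrite addr0 eqxx; apply/matrixP=> i j; rewrite mulrz_mxE !mxE.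
by apply/matrixP=> a' j; rewrite !mxE eq_sym neq.
Qed.

(** The default only makes the update branch total; [eff_next] selects that branch only for actual
    updates. *)
Definition act_upd (a : option (option (upd_t n N))) : upd_t n N :=
  odflt (m, ord0) (odflt None a).

Lemma apply_updE (x : vec_t n N) (u : upd_t n N) j :
  (apply_upd (vval x) u ord0 j = bval (x ord0 j) + bval u.2 * (j == u.1)%:R)%R.
Proof. by rewrite !mxE eqxx. Qed.

Section NewEntries.
Variables (A : encType) (a : nat) (x : A -> vec_t n N) (u : A -> upd_t n N).
Hypotheses (hx : eff a x) (hu : eff a u).

(** The new entry is an integer and has no encoding. Its image under [g] is a function of the old
    entry and the update, small enough for a truth table; [g] is the range test or the
    re-encoding. *)
Lemma eff_new_entry (C : encType) b (j : 'I_n) (g : int -> C) : plen b C ->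
  eff (maxn a b + 10) (fun y => g (apply_upd (vval (x y)) (u y) ord0 j)).
Proof.
move=> hC.
have ht := eff_table B_ge (fun p : 'I_N.*2.+1 * upd_t n N =>
  g (bval p.1 + bval p.2.2 * (j == p.2.1)%:R)%R) (llen_pair llen_N llen_upd) hC.
have := eff_map2 B_ge (op := fun z v => g (bval z + bval v.2 * (j == v.1)%:R)%R) ht
  (eff_comp B_ge hx (eff_entry j)) hu.
move/(eff_ext (g := fun y => g (apply_upd (vval (x y)) (u y) ord0 j))) => h.
by apply: (eff_le B_ge) (h _) _ => [y|]; [rewrite apply_updE | lia].
Qed.

Lemma eff_in_range : eff (a + 20) (fun y => in_range N (apply_upd (vval (x y)) (u y))).
Proof.
have h1 (j : 'I_n) := eff_new_entry j (fun z => `|z| <= N) (llen_plen (llen_bool B_ge)).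
have := eff_big B_ge (d := 1) (r := enum 'I_n) true (eff_andb B_ge)
  (llen_plen (llen_bool B_ge)) (fun j _ => h1 j).
rewrite size_enum_ord => /(_ n_le1) h.
apply: (eff_le B_ge) (eff_ext h _) _ => [y|]; last by max_le.
rewrite big_all; apply/allP/forallP => h' j; first by apply: h'; rewrite mem_enum.
by move=> _; apply: h'.
Qed.

Lemma eff_new_vec : eff (a + 20) (fun y => vec_of (apply_upd (vval (x y)) (u y))).
Proof.
have h1 (i : 'I_1) (j : 'I_n) :=
  eff_new_entry j (fun z => inord (absz (z + N%:Z)%R) : 'I_N.*2.+1) (llen_plen llen_N).
apply: (eff_le B_ge) (eff_ext (eff_mx B_ge (d := 1) h1 _) _) _.
- by rewrite mul1n n_le1.
- by move=> y; apply/matrixP=> i j; rewrite (ord1 i) !mxE.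
by max_le.
Qed.

End NewEntries.

Lemma eff_next w : eff 110 (game_next w).
Proof.
have hx : eff 20 (fun st : St => st.2).
  by apply: (eff_le B_ge) (eff_snd _ plen_vec) _.
have hu : eff 20 (fun st : St => act_upd (adv_act w st)).
  exact: (eff_le B_ge (eff_comp B_ge (eff_act w) (eff_table B_ge act_upd llen_act (llen_plen llen_upd))) _).
have hr := eff_in_range hx hu.
have hv := eff_new_vec hx hu.
have hq : eff 20 (fun st => adv_act w st == Some None).
  exact: (eff_le B_ge (eff_comp B_ge (eff_act w) (eff_table B_ge
    (fun a => a == Some None) llen_act (llen_plen (llen_bool B_ge)))) _).
have hiu : eff 20 (fun st => isSome (odflt None (adv_act w st))).
  exact: (eff_le B_ge (eff_comp B_ge (eff_act w) (eff_table B_ge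
    (fun a => isSome (odflt None a)) llen_act (llen_plen (llen_bool B_ge)))) _).
have hok := eff_map2 B_ge (eff_andb B_ge) hiu hr.
have hrep := eff_comp B_ge eff_s eff_report.
have htt : eff 1 (fun st : St => tt) := eff_const B_ge St tt (plen_unit 0).
have hevq := eff_inr B_ge plen_key (eff_inr B_ge (plen_unit 0) (eff_pair B_ge htt hrep)).
have hevu := eff_inr B_ge plen_key (eff_inl B_ge (plen_pair B_ge (plen_unit 0) plen_ans) htt).
have h1 := eff_pair B_ge (eff_pair B_ge (eff_pair B_ge (eff_mem' w) eff_s) hevq) hx.
have h2 := eff_pair B_ge (eff_pair B_ge (eff_pair B_ge (eff_mem' w)
  (eff_update (eff_le B_ge eff_s (isT : 10 <= 20)) hu)) hevu) hv.
have h3 := eff_if B_ge plen_St hok h2 (eff_id plen_St).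
have h4 := eff_if B_ge plen_St hq h1 h3.
apply: (eff_le B_ge) (eff_ext h4 _) _ => // st; rewrite /game_next /act_upd.
by case: (adv_act w st) => [[u|]|].
Qed.

Lemma eff_bad w : eff 110 (bad w).
Proof.
have hx : eff 20 (fun st : St => st.2 ord0 m).
  exact: (eff_le B_ge (eff_comp B_ge (eff_snd _ plen_vec) (eff_entry m)) _).
have hq : eff 20 (fun st => adv_act w st == Some None).
  exact: (eff_le B_ge (eff_comp B_ge (eff_act w) (eff_table B_ge
    (fun a => a == Some None) llen_act (llen_plen (llen_bool B_ge)))) _).
have hrep := eff_comp B_ge eff_s eff_report.
have hsome : eff 0 (fun o : option (vec_t n N) => isSome o).
  by apply: eff_ext (eff_bit B _ 0) _; case.
(* An answer other than bot is the report of [A0], so its entry [m] can be read there. *)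
have hdet := eff_comp B_ge eff_s (eff_comp B_ge (eff_comp B_ge
  (eff_fst _ (plen_pair B_ge st_B plen_key)) (eff_fst _ st_B)) (eff_comp B_ge rep_B (eff_entry m))).
have hne := eff_table B_ge (fun p : 'I_N.*2.+1 * 'I_N.*2.+1 => p.1 != p.2)
  (llen_pair llen_N llen_N) (llen_plen (llen_bool B_ge)).
have h0 := eff_map2 B_ge (op := fun y z : 'I_N.*2.+1 => y != z) hne hdet hx.
have h1 := eff_map2 B_ge (eff_andb B_ge) (eff_comp B_ge hrep hsome) h0.
have h2 := eff_map2 B_ge (eff_andb B_ge) hq h1.
apply: (eff_le B_ge) (eff_ext h2 _) _ => // -[[[mm [[s h] sk]] e] x].
by rewrite /bad /=; do 2 case: ifP => //.
Qed.

Lemma eff_start : eff 20 start.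
Proof.
have h (C : encType) (c : C) e : plen e C -> e <= 9 -> eff 10 (fun _ : hash_key F n lam => c).
  by move=> hC le_e; apply: (eff_le B_ge) (eff_const B_ge _ c hC) _.
have hid := eff_id plen_key.
have h1 := eff_pair B_ge (eff_pair B_ge (h _ (det_setup A0) _ st_B isT) hid)
  (h _ (0%R : ct_t F lam) _ plen_ct isT).
have h2 := eff_pair B_ge (eff_pair B_ge (eff_pair B_ge
  (h mem_t (nseq_tuple (adv_mem adv) false) _ plen_mem isT) h1) (eff_inl B_ge plen_ev2 hid))
  (h _ (vec_of 0%R) _ plen_vec isT).
exact: (eff_le B_ge h2 _).
Qed.

Lemma eff_game ws : size ws <= B -> eff 150 (fun h => game h ws).
Proof.
move=> le_ws.
have h0 := eff_pair B_ge eff_start (eff_const B_ge _ false (llen_plen (llen_bool B_ge))).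
have hnext w : eff 130 (next_bad w).
  have hs := eff_fst bool plen_St.
  have hb := eff_snd St (llen_plen (llen_bool B_ge)).
  have hor := eff_table B_ge (fun p : bool * bool => p.1 || p.2)
    (llen_pair (llen_bool B_ge) (llen_bool B_ge)) (llen_plen (llen_bool B_ge)).
  have h1 := eff_pair B_ge (eff_comp B_ge hs (eff_next w))
     (eff_map2 B_ge hor hb (eff_comp B_ge hs (eff_bad w))).
  exact: (eff_le B_ge h1 _).
have := eff_foldl B_ge (d := 1) hnext h0; rewrite expn1 => /(_ ws le_ws) h.
exact: (eff_le B_ge (eff_comp B_ge h (eff_snd St (llen_plen (llen_bool B_ge)))) _).
Qed.

Lemma eff_game_pk ws cs : size ws <= B -> eff 200 (fun pk => game (pk, cs) ws).
Proof.
move=> le_ws.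
have h := eff_pair B_ge (eff_id pk_B) (eff_const B_ge (pk_t F lam) cs plen_cts).
exact: (eff_le B_ge (eff_comp B_ge h (eff_game le_ws)) _).
Qed.

Hypothesis rnd_B : plen 1 ((enc_coins F lam).-tuple bool).
Hypothesis enc_B : eff 1 (fun a : pk_t F lam * bool * (enc_coins F lam).-tuple bool =>
  fhe_enc a.1.1 a.1.2 a.2).

(** The distinguisher for ciphertext [i]. The public key is part of the challenge, so the
    ciphertexts before [i] have to be computed by the circuit, with hardwired coins [rs]. *)
Lemma eff_game_mix ws (b : (index_len n).-tuple bool) i rs cs : size ws <= B ->
  eff 200 (fun a : pk_t F lam * ct_t F lam => game (a.1, mix_at b i rs cs a) ws).
Proof.
move=> le_ws; pose X : encType := (pk_t F lam * ct_t F lam)%type.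
have hpk := eff_fst (ct_t F lam) pk_B.
have hj (j : 'I_(index_len n)) : eff 10 (fun a : X =>
    if j < i then fhe_enc a.1 (tnth b j) (rs j) else if j == i then a.2 else cs j).
  have henc := eff_comp B_ge (eff_pair B_ge (eff_pair B_ge hpk
    (eff_const B_ge X (tnth b j) (llen_plen (llen_bool B_ge))))
    (eff_const B_ge X (rs j) rnd_B)) enc_B.
  case: (j < i); first exact: (eff_le B_ge henc _).
  case: (j == i); first exact: (eff_le B_ge (eff_snd (pk_t F lam) plen_ct) _).
  exact: (eff_le B_ge (eff_const B_ge X (cs j) plen_ct) _).
have hmix := eff_ffun B_ge (d := 1) hj.
have le_l : index_len n <= B ^ 1.
  rewrite expn1; apply: leq_trans (_ : n <= B); last by lia.
  by apply: up_log_min => //; exact/ltnW/ltn_expl.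
exact: (eff_le B_ge (eff_comp B_ge (eff_pair B_ge hpk (hmix le_l)) (eff_game le_ws)) _).
Qed.

End Circuit.
End Game.

Local Open Scope ring_scope.

(** * Expectations *)

Section Expectation.
Variable R : realType.
Implicit Types T U : finType.

Lemma eq_E T (d : fdist R T) (f g : T -> R) : f =1 g -> E d f = E d g.
Proof. by move=> fg; apply: eq_bigr => x _; rewrite fg. Qed.

Lemma E_le T (d : fdist R T) (f g : T -> R) :
  (forall x, f x <= g x) -> E d f <= E d g.
Proof. by move=> fg; apply: ler_sum => x _; rewrite ler_wpM2l ?pmf_ge0. Qed.

Lemma E_const T (d : fdist R T) c : E d (fun=> c) = c.
Proof. by rewrite /E -mulr_suml pmf_sum1 mul1r. Qed.

Lemma E_dret T (a : T) (f : T -> R) : E (dret a) f = f a.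
Proof.
rewrite /E (bigD1 a) //= eqxx mul1r big1 ?addr0 // => x /negPf->.
by rewrite mul0r.
Qed.

Lemma E_dbind T U (d : fdist R T) (g : T -> fdist R U) f :
  E (dbind d g) f = E d (fun x => E (g x) f).
Proof.
rewrite /E; under eq_bigr do rewrite /= mulr_suml.
rewrite exchange_big; apply: eq_bigr => x _ /=.
by rewrite mulr_sumr; apply: eq_bigr => y _; rewrite mulrA.
Qed.

Lemma E_dmap T U (d : fdist R T) (g : T -> U) f :
  E (dmap g d) f = E d (fun x => f (g x)).
Proof. by rewrite E_dbind; apply: eq_E => x; rewrite E_dret. Qed.

Lemma E_dpair T U (d : fdist R T) (e : fdist R U) f :
  E (dpair d e) f = E d (fun x => E e (fun y => f (x, y))).
Proof. by rewrite E_dbind; apply: eq_E => x; rewrite E_dmap. Qed.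

Lemma E_sub T (d : fdist R T) f g : E d f - E d g = E d (fun x => f x - g x).
Proof. by rewrite -sumrB; apply: eq_bigr => x _; rewrite mulrBr. Qed.

Lemma E_sum T (d : fdist R T) (I : finType) (f : I -> T -> R) :
  E d (fun x => \sum_i f i x) = \sum_i E d (f i).
Proof. by rewrite exchange_big; apply: eq_bigr => x _; rewrite mulr_sumr. Qed.

Lemma E_exchange T U (d : fdist R T) (e : fdist R U) f :
  E d (fun x => E e (f x)) = E e (fun y => E d (f^~ y)).
Proof.
rewrite /E; under eq_bigr do rewrite mulr_sumr.
rewrite exchange_big; apply: eq_bigr => y _; rewrite mulr_sumr.
by apply: eq_bigr => x _; rewrite mulrCA.
Qed.

Lemma E_norm_le T (d : fdist R T) f c :
  (forall x, `|f x| <= c) -> `|E d f| <= c.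
Proof.
move=> fc; rewrite -[c](E_const d); apply: le_trans (ler_norm_sum _ _ _) _.
by apply: ler_sum => x _; rewrite normrM ger0_norm ?pmf_ge0 // ler_wpM2l ?pmf_ge0.
Qed.

Definition upd_at l T (z : {ffun 'I_l -> T}) (i : 'I_l) (y : T) : {ffun 'I_l -> T} :=
  [ffun j => if j == i then y else z j].

(** Exchanging coordinate [i] with an independent sample of [d] is an involution that preserves the
    product weight. *)
Lemma E_resample T (d : fdist R T) l (i : 'I_l) (f : {ffun 'I_l -> T} -> R) :
  E (diid d l) f = E (diid d l) (fun z => E d (fun y => f (upd_at z i y))).
Proof.
transitivity (E (diid d l) (fun z => E d (fun _ => f z))).
  by apply: eq_E => z; rewrite E_const.
pose swap (p : {ffun 'I_l -> T} * T) := (upd_at p.1 i p.2, p.1 i).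
have swapK : involutive swap.
  move=> [z y]; rewrite /swap /=; congr (_, _); last by rewrite ffunE eqxx.
  by apply/ffunP => j; rewrite !ffunE; case: eqP => [->|].
rewrite -(E_dpair (diid d l) d (fun p => f p.1)) -(E_dpair (diid d l) d (fun p => f (upd_at p.1 i p.2))).
have Ep (g : {ffun 'I_l -> T} * T -> R) :
    E (dpair (diid d l) d) g = \sum_(p : {ffun 'I_l -> T} * T) (\prod_j d (p.1 j)) * d p.2 * g p.
  rewrite E_dpair /E; under eq_bigr do rewrite mulr_sumr.
  by rewrite pair_bigA; apply: eq_bigr => p _ /=; rewrite mulrA; case: p.
rewrite !Ep (reindex_inj (inv_inj swapK)); apply: eq_bigr => -[z y] _ /=.
congr (_ * _); rewrite (bigD1 i) //= [in RHS](bigD1 i) //= ffunE eqxx.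
rewrite mulrAC [RHS]mulrAC (mulrC (d y)); congr (_ * _).
by apply: eq_bigr => j /negPf neq; rewrite ffunE neq.
Qed.

End Expectation.

(** * The wrong answers of the streaming algorithm *)

Section Answers.
Variables (R : realType) (F : fhe) (P : pseudorandomness F R).
Variables (n N k lam Tmax : nat) (A0 : det_stream_alg n N) (adv : adversary).
Implicit Types (h : hash_key F n lam) (w : (adv_coins adv).-tuple bool) (ws : seq ((adv_coins adv).-tuple bool)).
Notation coin := ((adv_coins adv).-tuple bool).
Notation S0 := (stream_alg_of P k lam A0).
Notation St := (game_state F lam A0 adv).

(** Draws the coins of all rounds in advance; nested expectations match the recursion of [play]. *)
Fixpoint E_coins (r : nat) (f : seq coin -> R) : R :=
  if r is r'.+1 then E (coins (adv_coins adv)) (fun w => E_coins r' (fun ws => f (w :: ws)))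
  else f [::].

Lemma E_coins_le r f g : (forall ws, size ws = r -> f ws <= g ws) ->
  E_coins r f <= E_coins r g.
Proof.
elim: r f g => [|r IH] f g fg /=; first exact: fg.
by apply: E_le => w; apply: IH => ws sz; apply: fg; rewrite /= sz.
Qed.

Lemma E_coins_const r c : E_coins r (fun=> c) = c.
Proof. by elim: r => //= r IH; under eq_E do rewrite IH; rewrite E_const. Qed.

Lemma E_E_coins (T : finType) (d : fdist R T) r (f : T -> seq coin -> R) :
  E d (fun x => E_coins r (f x)) = E_coins r (fun ws => E d (f^~ ws)).
Proof.
elim: r f => //= r IH f; rewrite E_exchange.
by apply: eq_E => w; apply: IH.
Qed.

Lemma bval_inord (z : int) : (`|z| <= N)%N ->
  bval (inord (absz (z + N%:Z)) : 'I_N.*2.+1) = z.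
Proof. by move=> le_z; rewrite /bval inordK; lia. Qed.

Lemma vec_ofK (x : 'rV[int]_n) : in_range N x -> vval (vec_of N x) = x.
Proof.
move=> /forallP x_in; apply/matrixP => i j; rewrite !mxE (ord1 i).
exact: bval_inord (x_in j).
Qed.

Lemma in_range0 : in_range N (0 : 'rV[int]_n).
Proof. by apply/forallP => i; rewrite mxE. Qed.

Lemma vval_inj : injective (@vval n N).
Proof.
move=> x y /matrixP eq_xy; apply/matrixP => i j; apply: val_inj.
by have := eq_xy i j; rewrite !mxE /bval /=; lia.
Qed.

Lemma hash0 (h : hash_key F n lam) : hash h (vec_of N 0) = 0.
Proof.
rewrite /hash vec_ofK ?in_range0 // big1 // => i _.
by rewrite mxE mulr0z.
Qed.

Lemma hash_upd (h : hash_key F n lam) (x : vec_t n N) (u : upd_t n N) :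
  in_range N (apply_upd (vval x) u) ->
  hash h x + index_ct h u.1 *~ bval u.2 = hash h (vec_of N (apply_upd (vval x) u)).
Proof.
move=> x_in; rewrite /hash vec_ofK //.
transitivity (hash h x + \sum_(i < n) index_ct h i *~ (bval u.2 * (i == u.1)%:R)).
  congr (_ + _); rewrite (bigD1 u.1) //= eqxx mulr1 big1 ?addr0 // => i /negPf->.
  by rewrite mulr0 mulr0z.
rewrite /hash -big_split; apply: eq_bigr => i _ /=.
by rewrite -mulrzDr !mxE.
Qed.

Definition consistent (h : hash_key F n lam) (st : St) : Prop :=
  st.1.1.2.1.2 = h /\ st.1.1.2.2 = hash h st.2.

(** The range test in [game_next] keeps [vec_of] faithful, so linearity of the hash, [hash_upd],
    applies to every accepted update. *)
Lemma consistent_next h w (st : St) : consistent h st -> consistent h (game_next k w st).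
Proof.
case: st => -[[mm [[s h'] sk]] e] x [/= -> ->]; rewrite /game_next.
case: adv_act => [[u|]|] //=; case: ifP => // x_in.
by split=> //=; rewrite hash_upd.
Qed.

Lemma consistent_start h : consistent h (start A0 adv h).
Proof. by split=> //=; rewrite hash0. Qed.

(** An answer other than bot has passed the comparison with the sketch, which is the hash of the
    true vector; so a bad answer is a collision at coordinate [m]. *)
Lemma bad_binding (m : 'I_n) h w (st : St) : consistent h st ->
  bad k m w st -> exists x x' : vec_t n N, hash h x = hash h x' /\ x ord0 m != x' ord0 m.
Proof.
case: st => -[[mm [[s h'] sk]] e] x [/= -> ->]; rewrite /bad /=.
case: ifP => _; rewrite ?andbF //; case: ifP => [/eqP eq_h|]; rewrite ?andbF //.
by case/andP=> _ neq; eexists; eexists; split; [apply: eq_h | apply: neq].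
Qed.

Lemma game_binding (m : 'I_n) h ws :
  (forall x x' : vec_t n N, hash h x = hash h x' -> x ord0 m = x' ord0 m) ->
  game k A0 m h ws = false :> bool.
Proof.
move=> bind; rewrite /game.
elim: ws (start _ _ h) (consistent_start h) => //= w ws IH st cst.
rewrite {2}/next_bad /=; have -> : bad k m w st = false.
  by apply/negP => /(bad_binding cst)[x [x' [/bind-> /eqP]]].
exact/IH/consistent_next.
Qed.

Lemma foldl_bad m ws (st : St) : (foldl (fun sb w => next_bad k m w sb) (st, true) ws).2.
Proof. by elim: ws st => //= w ws IH st; rewrite /next_bad /=; apply: IH. Qed.

Lemma foldl_bad_le m ws (st : St) b :
  ((foldl (fun sb w => next_bad k m w sb) (st, false) ws).2 <=
   (foldl (fun sb w => next_bad k m w sb) (st, b) ws).2)%N.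
Proof. by case: b; rewrite // foldl_bad leq_b1. Qed.

Hypothesis A0_correct : forall us : seq (upd_t n N),
  (size us <= Tmax)%N -> stream_ok us -> (norm0 (stream_vec us) <= k)%N ->
  vval (det_report (foldl (@det_update _ _ A0) (det_setup A0) us)) = stream_vec us.

(** Strengthens [consistent] by tying the state to a legal stream, to which [A0_correct] applies. *)
Definition reached (us : seq (upd_t n N)) h (st : St) : Prop :=
  [/\ (size us <= Tmax)%N, stream_ok us, vval st.2 = stream_vec us
    & st.1.1.2 = (foldl (@det_update _ _ A0) (det_setup A0) us, h, hash h st.2)].

Lemma stream_ok_rcons us (u : upd_t n N) : stream_ok us ->
  in_range N (apply_upd (stream_vec us) u) -> stream_ok (rcons us u).
Proof.
move=> ok_us u_in t; rewrite size_rcons leq_eqVlt => /predU1P[->|].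
  by rewrite -(size_rcons us u) take_size /stream_vec foldl_rcons.
by rewrite ltnS => le_t; rewrite -cats1 takel_cat //; apply: ok_us.
Qed.

(** On a sparse vector [A0] is right and its hash equals the sketch, so the answer is right. On any
    other vector only bot is right, so a wrong answer is a sparse vector, which differs from the
    true one somewhere. *)
Lemma incorrect_bad us h w (st : St) : reached us h st ->
  adv_act w st = Some None ->
  ~~ sparse_recovery_correct k (stream_vec us) (sa_report k st.1.1.2 tt) ->
  exists m, bad k m w st.
Proof.
case: st => -[[mm s] e] x [/= le_us ok_us x_us ->] act; rewrite /bad act eqxx /=.
rewrite /sparse_recovery_correct -x_us.
set x' := det_report _.
have x'_x : (norm0 (vval x) <= k)%N -> x' = x.
  by move=> le_k; apply: vval_inj; rewrite x_us A0_correct // -x_us.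
rewrite -/(hash h x'); case: (leqP (norm0 (vval x)) k) => [le_x|lt_x].
  by rewrite (x'_x le_x) ltnNge le_x /= !eqxx.
case: ifP => // le_x'; case: ifP => // _ _.
have [m neq] : exists m, x' ord0 m != x ord0 m.
  apply/existsP; apply: contraFT le_x'; rewrite negb_exists => /forallP eq_x.
  suff -> : x' = x by [].
  by apply/matrixP => i j; rewrite (ord1 i); apply/eqP; rewrite -[_ == _]negbK.
by exists m.
Qed.

Lemma take_adv_out w (st : St) a : adv_act w st = Some a ->
  take (adv_mem adv) (adv_out w st) = adv_mem' w st.
Proof.
rewrite /adv_act /bdec; case: pickP => // b /eqP/(congr1 size).
rewrite size_benc size_drop blen_option => eq_sz _.
have lt_sz : (adv_mem adv < size (adv_out w st))%N by rewrite -subn_gt0 -eq_sz.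
apply: (@eq_from_nth _ false); first by rewrite size_tuple size_takel // ltnW.
move=> i; rewrite size_takel ?(ltnW lt_sz) // => lti; rewrite nth_take //.
by rewrite (nth_mktuple _ _ (Ordinal lti)).
Qed.

Lemma E_coins_foldl_le r (st : St) (b : 'I_n -> bool) :
  E_coins r (fun ws => \sum_m
         ((foldl (fun sb w => next_bad k m w sb) (st, false) ws).2 : nat)%:R)
  <= E_coins r (fun ws => \sum_m
         ((foldl (fun sb w => next_bad k m w sb) (st, b m) ws).2 : nat)%:R).
Proof.
apply: E_coins_le => ws _; apply: ler_sum => m _.
by rewrite ler_nat foldl_bad_le.
Qed.

(** A union bound over the coordinates. Where the real game ends without failure it contributes 0,
    so it does no harm that the simulation goes on. *)
Lemma play_le r us h (st : St) : reached us h st ->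
  play (S := S0) Tmax (@sparse_recovery_correct n N k) adv r (st.1.1.1 : seq bool)
      st.1.1.2 st.1.2 (size us) (stream_vec us)
    <= E_coins r (fun ws => \sum_m
         ((foldl (fun sb w => next_bad k m w sb) (st, false) ws).2 : nat)%:R).
Proof.
elim: r us st => [|r IH] us st hst /=; first exact/sumr_ge0.
apply: E_le => w; rewrite -/(adv_out w st) -/(adv_act w st).
case act: (adv_act w st) => [[u|]|]; last first.
- rewrite -[X in X <= _](E_coins_const r); apply: E_coins_le => ws _.
  exact: sumr_ge0.
- rewrite E_dret (take_adv_out act).
  case: ifPn => [_|/(incorrect_bad hst act)[m bad_m]]; last first.
    rewrite -[X in X <= _](E_coins_const r); apply: E_coins_le => ws _.
    (* The flag of [m] is raised now and persists, so the sum is at least 1. *)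
    rewrite (bigD1 m) //= /next_bad /= bad_m foldl_bad lerDl.
    exact: sumr_ge0.
  apply: le_trans (E_coins_foldl_le _ _ (fun m => bad k m w st)).
  have -> : game_next k w st = (adv_mem' w st, st.1.1.2, inr (inr (tt, sa_report k st.1.1.2 tt)), st.2).
    by rewrite /game_next act.
  by apply: (IH us (adv_mem' w st, st.1.1.2, inr (inr (tt, sa_report k st.1.1.2 tt)), st.2)); case: hst.
case: ifP => [/andP[lt_us x_in]|_]; last first.
  rewrite -[X in X <= _](E_coins_const r); apply: E_coins_le => ws _.
  exact: sumr_ge0.
rewrite E_dret (take_adv_out act).
apply: le_trans (E_coins_foldl_le _ _ (fun m => bad k m w st)).
case: hst => le_us ok_us x_us s_us.
have -> : game_next k w st = (adv_mem' w st, sa_update st.1.1.2 u tt, inr (inl tt),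
     vec_of N (apply_upd (vval st.2) u)).
  by rewrite /game_next act x_us x_in.
have := IH (rcons us u) (adv_mem' w st, sa_update st.1.1.2 u tt, inr (inl tt),
     vec_of N (apply_upd (vval st.2) u)).
rewrite size_rcons [stream_vec (rcons us u)]foldl_rcons -/(stream_vec us); apply.
split; rewrite ?size_rcons //=.
- exact: stream_ok_rcons.
- by rewrite vec_ofK x_us // [stream_vec (rcons us u)]foldl_rcons.
- by rewrite s_us /= foldl_rcons hash_upd // x_us.
Qed.

Lemma play_start_le r h :
  play (S := S0) Tmax (@sparse_recovery_correct n N k) adv r
      (nseq (adv_mem adv) false) (sa_setup A0 h) (inl h) 0 0
    <= E_coins r (fun ws => \sum_m (game k A0 m h ws : nat)%:R).
Proof.
apply: (@play_le r [::] h (start A0 adv h)); split=> //=.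
- by move=> t; rewrite leqn0 => /eqP->; rewrite take0; apply: in_range0.
- by rewrite vec_ofK ?in_range0.
- by rewrite hash0.
Qed.

End Answers.

Local Open Scope nat_scope.

(** * Well-formedness and depth of the point circuits *)

Lemma cdepth_le_size l C : cdepth l C <= size (gates C).
Proof.
rewrite /cdepth; set ds := foldl _ _ _.
suff le_ds : forall i, nth 0 ds i <= size (gates C).
  by apply/bigmax_leqP_seq => i _ _; apply: le_ds.
rewrite /ds; elim/last_ind: (gates C) => [|gs g IH] i.
  by rewrite nth_nseq if_same.
rewrite foldl_rcons nth_rcons size_rcons.
case: ifP => _; first exact: leqW.
case: ifP => // _; case: g => [b|j|j j'] //=; rewrite ltnS ?geq_max ?IH //.
Qed.

Fixpoint gates_wf (w : nat) (gs : seq gate) : bool :=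
  if gs is g :: gs' then gate_wf w g && gates_wf w.+1 gs' else true.

Lemma gates_wfE w gs :
  gates_wf w gs = all (fun j => gate_wf (w + j) (nth (GConst false) gs j)) (iota 0 (size gs)).
Proof.
elim: gs w => //= g gs IH w; rewrite addn0 IH (iotaDl 1 0) all_map; congr (_ && _).
by apply: eq_all => j /=; rewrite addSnnS.
Qed.

Lemma point_gates_wf l bs j : j + size bs <= l ->
  gates_wf (l + j.*2).+1 (point_gates l j bs).
Proof.
elim: bs j => //= b bs IH j le_l.
have lt_j : j < (l + j.*2).+1 by lia.
apply/andP; split; first by case: b => /=; rewrite lt_j.
have := IH j.+1; rewrite doubleS !addnS addSn => -> //; last by rewrite -addnS.
by rewrite /= leqnn andbT; lia.
Qed.

Lemma size_point_gates l j bs : size (point_gates l j bs) = (size bs).*2.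
Proof. by elim: bs j => //= b bs IH j; rewrite IH doubleS. Qed.

Lemma point_circuit_wf l i : circuit_wf l 1 (point_circuit l i).
Proof.
rewrite /circuit_wf -gates_wfE /= andbT; apply/andP; split.
  by have := @point_gates_wf l (bin l i) 0; rewrite addn0 size_bin; apply.
by rewrite size_point_gates size_bin andbT; lia.
Qed.

Lemma cdepth_point_circuit l i : cdepth l (point_circuit l i) <= l.*2.+1.
Proof.
by apply: leq_trans (cdepth_le_size _ _) _; rewrite /= size_point_gates size_bin.
Qed.

Local Open Scope ring_scope.

(** * Binding under real keys *)

Definition index_bits n (m : 'I_n) : (index_len n).-tuple bool :=
  Tuple (introT eqP (size_bin (index_len n) m)).

(** The [i]-th evaluated ciphertext decrypts to the bit [i == m], so [linear_dec] maps the hash of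
    [y] to entry [m] of [y]. The threshold depends on the depth bound [d] only, not on [n], [N] or
    [m]. *)
Lemma real_binding (R : realType) (F : fhe) (P : pseudorandomness F R) (d : nat -> nat) :
  poly_bounded d -> fhe_correct F -> linear_homomorphic P ->
  exists lam0 : nat, forall lam n N (m : 'I_n), (lam0 <= lam)%N ->
    ((index_len n).*2.+1 <= d lam)%N -> (margin P lam * (n * N) <= modulus F lam)%N ->
  forall (w : (setup_coins F lam).-tuple bool) (r : 'I_(index_len n) -> (enc_coins F lam).-tuple bool)
    (x x' : vec_t n N),
  let h : hash_key F n lam := ((fhe_setup w).1, enc_all (fhe_setup w).1 (index_bits m) r) in
  hash h x = hash h x' -> x ord0 m = x' ord0 m.
Proof.
move=> d_poly /(_ d d_poly)[lam1 correct] [_ /(_ d d_poly)[lam2 linear]].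
exists (maxn lam1 lam2) => lam n N m; rewrite geq_max => /andP[le1 le2] le_d le_q w r x x' h.
have le_bval (z : 'I_N.*2.+1) : (`|bval z| <= N)%N by rewrite /bval; have := ltn_ord z; lia.
pose v (i : 'I_n) := nseq_tuple (dec_coins F lam) false.
suff dec_x : forall y : vec_t n N, bval (linear_dec P (fhe_setup w).1 (fhe_setup w).2 (hash h y)) = bval (y ord0 m).
  by move=> eq_h; apply: val_inj; have := dec_x x; rewrite eq_h dec_x => /addIr[] /= ->.
move=> {x x'} y; have := linear lam le2 w n (fun i => vval y ord0 i) (fun i => index_ct h i) v.
have := correct lam le1 w (index_len n).
rewrite /h; case: (fhe_setup w) => pk sk /= {}correct -> //.
- have dec_ct i : fhe_dec pk sk (index_ct (pk, enc_all pk (index_bits m) r) i) (v i) = (i == m).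
    have := correct (point_circuit (index_len n) i) (index_bits m) r (v i)
      (point_circuit_wf _ _) (leq_trans (cdepth_point_circuit _ _) le_d).
    rewrite point_circuitP ?size_bin // => -[->]; apply/eqP/eqP => [/bin_inj eq_mi|-> //].
    by apply/val_inj/esym/eq_mi; apply: leq_trans (ltn_ord _) (up_logP _ _).
  rewrite (bigD1 m) //= big1 => [|i /negPf neq_im].
    by rewrite addr0 dec_ct eqxx mulr1 mxE.
  by rewrite dec_ct neq_im mulr0.
- move=> i; exists (index_len n), (point_circuit (index_len n) i), (index_bits m), r.
  by split=> //; [apply: point_circuit_wf | apply: leq_trans (cdepth_point_circuit _ _) le_d].
apply: leq_trans le_q; rewrite !leq_mul2l; apply/orP; right; apply/orP; right.
by apply/bigmax_leqP => i _; rewrite mxE le_bval.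
Qed.

(** * Hybrids *)

Section Hybrid.
Variables (R : realType) (F : fhe) (P : pseudorandomness F R) (lam l : nat).
Variables (b : l.-tuple bool) (f : pk_t F lam * {ffun 'I_l -> ct_t F lam} -> bool).
Variables (t : nat) (eps : R).
Implicit Types (pk : pk_t F lam) (cs : {ffun 'I_l -> ct_t F lam}).
Implicit Types (rs : {ffun 'I_l -> (enc_coins F lam).-tuple bool}).

Definition mix (i : nat) pk rs cs : {ffun 'I_l -> ct_t F lam} :=
  [ffun j : 'I_l => if (j < i)%N then fhe_enc pk (tnth b j) (rs j) else cs j].

Hypothesis pk_ind : forall D, (pcost D <= t)%N ->
  `|E (dist_pk P lam) (accept R D) - E (law_pk F R lam) (accept R D)| <= eps.
Hypothesis ct_ind : forall mu D, (pcost D <= t)%N ->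
  `|E (dpair (law_pk F R lam) (dist_ct P lam)) (accept R D)
      - E (law_pk_enc F R mu lam) (accept R D)| <= eps.
Hypothesis f_pk : forall cs, exists2 C, (csize C <= t)%N &
  computes C (fun pk => f (pk, cs)).
Hypothesis f_ct : forall i rs cs, exists2 C, (csize C <= t)%N &
  computes C (fun a : pk_t F lam * ct_t F lam => f (a.1, mix_at b i rs cs a)).

Lemma accept_det (A : encType) C (g : A -> bool) :
  computes C g -> accept R (PCircuit 0 C) =1 (fun a : A => (g a)%:R).
Proof.
move=> gC a; rewrite /accept /pout -[RHS](E_const (coins 0)); apply: eq_E => w.
by rewrite tuple0 /= cats0 gC.
Qed.

(** All encryption coins and all ideal ciphertexts are sampled whatever [i] is, so that all hybrids
    share one sample space. *)
Definition hybrid (i : nat) : R :=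
  E (coins (setup_coins F lam)) (fun w => E (diid (coins (enc_coins F lam)) l) (fun rs =>
    E (diid (dist_ct P lam) l) (fun cs =>
      (f ((fhe_setup w).1, mix i (fhe_setup w).1 rs cs))%:R))).

Lemma ideal_hybrid0 :
  `|E (dpair (dist_pk P lam) (diid (dist_ct P lam) l)) (fun h => (f h)%:R) - hybrid 0| <= eps.
Proof.
have -> : hybrid 0 = E (diid (dist_ct P lam) l) (fun cs =>
    E (law_pk F R lam) (fun pk => (f (pk, cs))%:R)).
  rewrite E_exchange E_dmap; apply: eq_E => w.
  rewrite -[RHS](E_const (diid (coins (enc_coins F lam)) l)); apply: eq_E => rs.
  apply: eq_E => cs; congr (f (_, _))%:R.
  by apply/ffunP => j; rewrite ffunE.
rewrite E_dpair E_exchange E_sub; apply: E_norm_le => cs.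
have [C leC /accept_det eC] := f_pk cs.
by have := pk_ind (D := PCircuit 0 C) leC; rewrite !(eq_E _ eC).
Qed.

(** Position [i] is made a separate sample with [E_resample]: of [cs] in the first hybrid, of [rs]
    in the second. For fixed remaining samples the two are the two sides of [ct_ind], and averaging
    preserves the bound. *)
Lemma hybrid_step (i : 'I_l) : `|hybrid i - hybrid i.+1| <= eps.
Proof.
pose g rs cs a : R := (f (a.1, mix_at b i rs cs a))%:R.
have -> : hybrid i = E (diid (coins (enc_coins F lam)) l) (fun rs =>
    E (diid (dist_ct P lam) l) (fun cs =>
      E (dpair (law_pk F R lam) (dist_ct P lam)) (g rs cs))).
  rewrite /hybrid E_exchange; apply: eq_E => rs.
  under [RHS]eq_E do rewrite E_dpair E_dmap.
  rewrite [RHS]E_exchange; apply: eq_E => w.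
  rewrite (E_resample _ i); apply: eq_E => cs; apply: eq_E => c.
  congr (f (_, _))%:R; apply/ffunP => j; rewrite !ffunE /=.
  by case: ltnP => // _; case: eqP.
have -> : hybrid i.+1 = E (diid (coins (enc_coins F lam)) l) (fun rs =>
    E (diid (dist_ct P lam) l) (fun cs =>
      E (law_pk_enc F R (tnth b i) lam) (g rs cs))).
  transitivity (E (coins (setup_coins F lam)) (fun w =>
      E (diid (coins (enc_coins F lam)) l) (fun rs =>
      E (diid (dist_ct P lam) l) (fun cs =>
      E (coins (enc_coins F lam)) (fun r =>
       g rs cs ((fhe_setup w).1, fhe_enc (fhe_setup w).1 (tnth b i) r)))))).
    apply: eq_E => w; rewrite (E_resample _ i); apply: eq_E => rs.
    rewrite [RHS]E_exchange; apply: eq_E => r; apply: eq_E => cs.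
    congr (f (_, _))%:R; apply/ffunP => j; rewrite !ffunE /=.
    rewrite ltnS leq_eqVlt val_eqE.
    by case: eqVneq => [->|] //=; rewrite ltnn.
  rewrite E_exchange; apply: eq_E => rs; rewrite E_exchange; apply: eq_E => cs.
  by rewrite E_dbind; apply: eq_E => w; rewrite E_dmap.
rewrite E_sub; apply: E_norm_le => rs; rewrite E_sub; apply: E_norm_le => cs.
have [C leC /accept_det eC] := f_ct i rs cs.
by have := ct_ind (tnth b i) (D := PCircuit 0 C) leC; rewrite !(eq_E _ eC).
Qed.

(** One step replaces the public key and [l] steps replace the ciphertexts; the last hybrid is 0 by
    hypothesis. *)
Lemma ideal_real :
  (forall w rs, f ((fhe_setup w).1, enc_all (fhe_setup w).1 b rs) = false) ->
  E (dpair (dist_pk P lam) (diid (dist_ct P lam) l)) (fun h => (f h)%:R) <= l.+1%:R * eps.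
Proof.
move=> f0; have hyb_l : hybrid l = 0.
  rewrite -[RHS](E_const (coins (setup_coins F lam))); apply: eq_E => w.
  rewrite -[RHS](E_const (diid (coins (enc_coins F lam)) l)); apply: eq_E => rs.
  rewrite -[RHS](E_const (diid (dist_ct P lam) l)); apply: eq_E => cs.
  suff -> : mix l (fhe_setup w).1 rs cs = enc_all (fhe_setup w).1 b rs by rewrite f0.
  by apply/ffunP => j; rewrite !ffunE ltn_ord.
have hyb i : (i <= l)%N -> hybrid 0 - hybrid i <= i%:R * eps.
  elim: i => [|i IH] lt_il; first by rewrite subrr mul0r.
  rewrite -(subrKA (hybrid i)) -natr1 mulrDl mul1r.
  apply: lerD (IH (ltnW lt_il)) _; apply: le_trans (ler_norm _) _.
  exact: (hybrid_step (Ordinal lt_il)).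
have := hyb l (leqnn l); rewrite hyb_l subr0 => le0.
rewrite -(subrK (hybrid 0) (E _ _)) -natr1 addrC mulrDl mul1r; apply: lerD => //.
exact: le_trans (ler_norm _) ideal_hybrid0.
Qed.

End Hybrid.

(** * The security parameter is at least polylogarithmic *)

(** A truth table over all keys and ciphertexts can tell whether a ciphertext is an encryption of 1.
    By correctness no encryption of 0 is one, so it always guesses right and has advantage 1. *)
Lemma brute_force (R : realType) (F : fhe) (T : nat -> nat) (eps : nat -> R) :
  fhe_correct F -> fhe_secure F T eps ->
  exists lam0 : nat, forall lam, (lam0 < lam)%N ->
    (14 * 2 ^ blen (pk_t F lam * ct_t F lam)%type <= T lam)%N -> 1 <= eps lam.
Proof.
(* Depth 0 suffices because only the identity circuit is evaluated. *)
move=> /(_ (fun=> 0%N)) []; first by exists 0%N.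
move=> lam1 correct [lam2 secure]; exists (maxn lam1 lam2) => lam.
rewrite gtn_max => /andP[lt1 lt2] le_T.
pose test (a : pk_t F lam * ct_t F lam) : bool :=
  [exists r : (enc_coins F lam).-tuple bool, a.2 == fhe_enc a.1 true r].
pose g s := if bdec (pk_t F lam * ct_t F lam)%type s is Some a then test a else false.
have [C leC eC] := cx_table (@size_benc (pk_t F lam * ct_t F lam)%type)
  (iota 0 (blen (pk_t F lam * ct_t F lam)%type)) g.
rewrite size_iota in leC.
have {}eC a : ceval C (benc a) = [:: test a].
  rewrite eC /g; suff -> : [seq nth false (benc a) i | i <- iota 0 (blen (pk_t F lam * ct_t F lam)%type)] = benc a.
    by rewrite bdec_benc.
  by rewrite -(size_benc a); exact: mkseq_nth.
have testE w mu r : test ((fhe_setup w).1, fhe_enc (fhe_setup w).1 mu r) = mu.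
  apply/existsP/idP => [[r' /= /eqP eq_ct]|->]; last by exists r; rewrite /=.
  have dec mu' (r0 : (enc_coins F lam).-tuple bool) :=
    correct lam (ltnW lt1) w 1%N (Circuit [::] [:: 0%N]) [tuple mu'] (fun=> r0)
      (nseq_tuple _ false) isT.
  have wf : (cdepth 1 (Circuit [::] [:: 0%N]) <= 0)%N by rewrite /cdepth /= big_seq1.
  have := dec true r' wf; have := dec mu r wf; case: (fhe_setup w) eq_ct => pk sk /= eq_ct.
  have -> : enc_all pk [tuple mu] (fun=> r) = enc_all pk [tuple true] (fun=> r').
    by apply/ffunP => j; rewrite !ffunE (ord1 j) /= !(tnth_nth false) /=.
  by move=> -> [].
have := secure lam lt2 (PCircuit 0 C).
rewrite /guess_prob.
have -> : E (coins (setup_coins F lam)) (fun w => E (unif R true) (fun mu =>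
  E (coins (enc_coins F lam)) (fun r => E (coins (pcoins (PCircuit 0 C))) (fun v =>
    let pk := (fhe_setup w).1 in
    (pout (PCircuit 0 C) (pk, fhe_enc pk mu r) v == mu)%:R)))) = 1 :> R.
  rewrite -[RHS](E_const (coins (setup_coins F lam))); apply: eq_E => w.
  rewrite -[RHS](E_const (unif R true)); apply: eq_E => mu.
  rewrite -[RHS](E_const (coins (enc_coins F lam))); apply: eq_E => r.
  rewrite -[RHS](E_const (coins 0)); apply: eq_E => v.
  by rewrite /pout tuple0 /= cats0 eC testE eqxx.
move=> h; apply: le_trans (h _); last first.
  by apply: leq_trans le_T; rewrite /pcost add0n (leq_trans leC) ?leq_subr.
by rewrite distrC ger0_norm; lra.
Qed.

Local Open Scope nat_scope.

(** * Polynomial bounds *)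

(** With a base of at least 2, a single power also dominates constants and is monotone in the
    exponent, so closure properties need no additive term. *)
Definition pbound (g : nat -> nat) : Prop := exists c, forall n, g n <= n.+2 ^ c.

Lemma leq_exp2rW m n e : m <= n -> m ^ e <= n ^ e.
Proof. by case: e => // e le_mn; rewrite leq_exp2r. Qed.

Lemma poly_le x c : x ^ c + c <= x.+2 ^ c.+1.
Proof.
rewrite expnS; have h1 : x ^ c <= x.+2 ^ c by apply: leq_exp2rW; lia.
have h2 : c <= x.+2 ^ c by apply/ltnW/ltn_expl.
by apply: leq_trans (leq_add h1 h2) _; rewrite addnn -mul2n leq_mul2r orbT.
Qed.

Lemma poly_boundedE g : poly_bounded g <-> pbound g.
Proof.
split=> -[c hc]; first by exists c.+1 => n; apply: leq_trans (hc n) (poly_le n c).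
(* The constant covers [n <= 1]; from 2 on, [n + 2 <= n ^ 2]. *)
exists (2 * c + 3 ^ c) => n; apply: leq_trans (hc n) _.
case: n {hc} => [|[|n]].
- by apply: leq_trans (_ : 3 ^ c <= _); [apply: leq_exp2rW | lia].
- by lia.
apply: leq_trans (leq_addr _ _); apply: leq_trans (leq_pexp2l _ (leq_addr _ _)) => //.
by rewrite expnM; apply: leq_exp2rW; lia.
Qed.

Lemma pbound_le g g' : (forall n, g n <= g' n) -> pbound g' -> pbound g.
Proof. by move=> le_g [c hc]; exists c => n; apply: leq_trans (hc n). Qed.

Lemma pbound_add g g' : pbound g -> pbound g' -> pbound (fun n => g n + g' n).
Proof.
move=> [c hc] [d hd]; exists (c + d).+1 => n.
have hc' : g n <= n.+2 ^ (c + d) by rewrite (leq_trans (hc n)) // leq_pexp2l // leq_addr.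
have hd' : g' n <= n.+2 ^ (c + d) by rewrite (leq_trans (hd n)) // leq_pexp2l // leq_addl.
by rewrite expnS; apply: leq_trans (leq_add hc' hd') _; rewrite addnn -mul2n leq_mul2r orbT.
Qed.

Lemma pbound_id : pbound id. Proof. by exists 1 => n; lia. Qed.
Lemma pbound_const a : pbound (fun=> a).
Proof. by exists a => n; apply/ltnW/ltn_expl. Qed.

Lemma pbound_mul g g' : pbound g -> pbound g' -> pbound (fun n => g n * g' n).
Proof. by move=> [c hc] [d hd]; exists (c + d) => n; rewrite expnD leq_mul. Qed.

Lemma pbound_exp g c : pbound g -> pbound (fun n => g n ^ c).
Proof.
move=> [d hd]; by exists (d * c) => n; rewrite expnM leq_exp2rW.
Qed.

Lemma pbound_comp g s : pbound g -> pbound s -> pbound (fun n => g (s n)).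
Proof.
move=> [c hc] hs; apply: pbound_le (fun n => hc (s n)) _; apply: pbound_exp.
by apply: pbound_le (pbound_add hs (pbound_const 2)) => n; rewrite addn2.
Qed.

(** * Growth of the security parameter *)

Section SecurityParameter.
Variables (R : realType) (T S : nat -> nat) (eps : nat -> R).
Hypothesis T_large : forall c : nat, exists n0 : nat, forall n,
  n0 <= n -> n ^ c <= T (S n).
Hypothesis eps_small : exists negl : nat -> R,
  negligible negl /\ forall n, (eps (S n) <= negl n)%R.

(** On parameters up to [L] the function [T] is bounded by its maximum, while [T (S n)] is
    eventually at least [n]. *)
Lemma security_unbounded L : exists n0, forall n, n0 <= n -> L < S n.
Proof.
have [n1 T1] := T_large 1.
exists (maxn n1 (\max_(lam < L.+1) T lam).+1) => n; rewrite geq_max => /andP[le1 le2].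
rewrite ltnNge; apply/negP => le_S; have := T1 n le1; rewrite expn1 leqNgt => /negP[].
apply: leq_trans le2; rewrite ltnS.
exact: (leq_bigmax (F := fun lam : 'I_L.+1 => T lam) (Ordinal (le_S : S n < L.+1))).
Qed.

(** Since [eps (S n) < 1], the truth table attack must exceed the time bound. So
    [n <= T (S n) < 14 * 2 ^ K <= 2 ^ (K + 4)], with [K] the length of a key and a ciphertext. *)
Lemma index_len_le (F : fhe) : fhe_correct F -> fhe_secure F T eps ->
  exists n0, forall n, n0 <= n ->
    index_len n <= blen (pk_t F (S n) * ct_t F (S n))%type + 4.
Proof.
move=> correct /(brute_force correct)[lam0 brute].
have [n1 S1] := security_unbounded lam0.
have [n2 T2] := T_large 1.
have [negl [small le_negl]] := eps_small; have [n3 small3] := small 1 isT.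
exists (maxn n1 (maxn n2 n3.+1)) => n; rewrite !geq_max => /and3P[le1 le2 le3].
apply: up_log_min => //.
have := T2 n le2; rewrite expn1 => le_T.
have := brute (S n) (S1 n le1); case: leqP => [_ /(_ isT) eps1|lt_T _].
  have lt1 : (eps (S n) < 1)%R.
    apply: le_lt_trans (le_negl n) (lt_le_trans (small3 n le3) _).
    by rewrite expr1 invf_le1 ?ler1n ?ltr0n //; lia.
  by move: eps1; rewrite leNgt lt1.
by rewrite expnD (leq_trans le_T) // (leq_trans (ltnW lt_T)) // mulnC leq_mul.
Qed.

End SecurityParameter.

(** The public key is an input of [fhe_enc], so its length is bounded by the efficiency of
    encryption. *)
Lemma pbound_depth (F : fhe) : fhe_efficient F -> fhe_compact F ->
  pbound (fun lam => blen (pk_t F lam * ct_t F lam)%type).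
Proof.
move=> [_ [c enc] _ _] /poly_boundedE compact.
apply: pbound_le (pbound_add (pbound_add (pbound_exp c pbound_id) (pbound_const c)) compact) => lam.
rewrite blen_pair leq_add2r; have [+ _] := enc lam.
by apply: leq_trans; rewrite !blen_pair -addnA leq_addr.
Qed.

Lemma ctdim_le (F : fhe) lam : ctdim F lam <= blen (ct_t F lam).
Proof.
rewrite blen_mx mul1n leq_pmulr // up_log_gt0.
by rewrite Zp_cast ?modulus_gt1.
Qed.

(** * Resources of adversaries, and the idle ones *)

Lemma adv_time_ge A : adv_rounds A != 0 -> csize (adv_step A) != 0 ->
  [/\ adv_mem A <= adv_time A, adv_rounds A <= adv_time A, adv_coins A <= adv_time A
    & csize (adv_step A) <= adv_time A].
Proof. by rewrite /adv_time => rounds0 step0; split; nia. Qed.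

Section IdleAdversary.
Variables (R : realType) (n N Tmax : nat).
Variables (correct : 'rV[int]_n -> option (vec_t n N) -> bool).
Variables (S : stream_alg R n N) (A : adversary).

(** This is where the running time, a product, does not bound all resources. Without rounds nothing
    happens; a circuit without outputs writes an invalid action at once. *)
Lemma fail_prob_idle : (adv_rounds A == 0) || (csize (adv_step A) == 0) ->
  fail_prob Tmax correct S A = 0%R.
Proof.
move=> idle; rewrite /fail_prob -[RHS](E_const (setup_dist S)); apply: eq_E => r.
case: adv_rounds idle => //= m /eqP; rewrite /csize => /eqP; rewrite addn_eq0 => /andP[_ /nilP out0].
rewrite -[RHS](E_const (coins (adv_coins A))); apply: eq_E => w.
rewrite /ceval out0 /= /bdec; case: pickP => // a /eqP/(congr1 size).
by rewrite size_benc.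
Qed.

End IdleAdversary.

Local Open Scope ring_scope.

Theorem mainTheorem2 (R : realType) (N k Tmax : nat -> nat)
    (A0 : forall n : nat, det_stream_alg n (N n))
    (F : fhe) (P : pseudorandomness F R)
    (T : nat -> nat) (eps : nat -> R) (S : nat -> nat)
    (N_poly : poly_bounded N) (Tmax_poly : poly_bounded Tmax)
    (A0_time : det_poly_time A0)
    (A0_correct : relaxed_sparse_recovery k Tmax A0)
    (P_pseudorandom : pseudorandom_fhe T eps P)
    (F_secure : fhe_secure F T eps)
    (S_poly : poly_bounded S)
    (q_poly : poly_bounded (fun n => modulus F (S n)))
    (q_large : forall n, (margin P (S n) * (n * N n) <= modulus F (S n))%N)
    (T_large : forall c : nat, exists n0 : nat, forall n,
       (n0 <= n)%N -> (n ^ c <= T (S n))%N)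
    (eps_small : exists negl : nat -> R,
       negligible negl /\ forall n, eps (S n) <= negl n) :
  white_box_robust Tmax
    (fun n => @sparse_recovery_correct n (N n) (k n))
    (fun n => stream_alg_of P (k n) (S n) (A0 n)).
Proof.
move=> A A_poly c c_gt0.
have [[F_eff F_compact F_correct] pk_ind ct_ind F_linear] := P_pseudorandom.
have [c_upd upd] := A0_time.1; have [c_rep rep] := A0_time.2.
have [_ [c_enc enc] _ eval] := F_eff.
pose K lam := blen (pk_t F lam * ct_t F lam)%type.
(* The depth bound for point circuits, with [index_len_le] substituted for the index length. *)
pose d lam := (K lam + 4).*2.+1.
have d_poly : poly_bounded d.
  apply/poly_boundedE.
  have := pbound_add (pbound_mul (pbound_const 2) (pbound_depth F_eff F_compact)) (pbound_const 9).
  apply: pbound_le => lam.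
  by rewrite /d /K; lia.
have [c_eval {}eval] := eval d d_poly.
have [n1 len_le] := index_len_le T_large eps_small F_correct F_secure.
have [lam1 binding] := real_binding d_poly F_correct F_linear.
have [lam2 {}pk_ind] := pk_ind.
have [lam3 ct_indT] := ct_ind true; have [lam4 ct_indF] := ct_ind false.
have [n2 S_large] := security_unbounded T_large (lam1 + lam2 + lam3 + lam4).
pose g_A0 n := (n ^ c_upd + c_upd + (n ^ c_rep + c_rep))%N.
(* A point circuit on [l <= n] bits has [2 l + 1] gates and one output, hence the bound
   [2 n + 2]. *)
pose g_F n := (S n ^ c_enc + c_enc + ((S n + n + n.*2.+2) ^ c_eval + c_eval))%N.
pose g n := (16 + 2 * n.+2 + 2 * (N n).*2.*2.+1 + 2 * modulus F (S n) + K (S n)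
  + adv_time (A n) + g_A0 n + g_F n)%N.
have /poly_boundedE S_bound := S_poly; have /poly_boundedE N_bound := N_poly.
have /poly_boundedE q_bound := q_poly; have /poly_boundedE A_bound := A_poly.
have [c0 g_le] : pbound g.
  have n_bound : pbound (fun n => 2 * n.+2)%N.
    by have := pbound_add (pbound_mul (pbound_const 2) pbound_id) (pbound_const 4); apply: pbound_le => x; lia.
  have N4_bound : pbound (fun n => 2 * (N n).*2.*2.+1)%N.
    by have := pbound_add (pbound_mul (pbound_const 8) N_bound) (pbound_const 2); apply: pbound_le => x; lia.
  have q2_bound := pbound_mul (pbound_const 2) q_bound.
  have K_bound := pbound_comp (pbound_depth F_eff F_compact) S_bound.
  have exp_bound h e : pbound h -> pbound (fun n => h n ^ e + e)%N.
    by move=> h_bound; apply: pbound_add (pbound_exp e h_bound) (pbound_const e).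
  have A0_bound : pbound g_A0 := pbound_add (exp_bound _ _ pbound_id) (exp_bound _ _ pbound_id).
  have F_bound : pbound g_F.
    apply: pbound_add (exp_bound _ _ S_bound) (exp_bound _ _ _).
    by apply: pbound_add (pbound_add S_bound pbound_id) (pbound_le _ n_bound) => x; lia.
  exact: pbound_add (pbound_add (pbound_add (pbound_add (pbound_add (pbound_add (pbound_add
    (pbound_const 16) n_bound) N4_bound) q2_bound) K_bound) A_bound) A0_bound) F_bound.
(* The distinguishers have size at most [B ^ 200] with [B = (n + 2) ^ c0]; the factor 2 comes from
   [n + 2 <= n ^ 2]. *)
have [n3 T_le] := T_large (2 * (c0 * 200))%N.
(* The union bound and the hybrids lose a factor [n * (index_len n + 1)], which is at most
   [n ^ 3]. *)
have [negl [small le_negl]] := eps_small; have [n4 {}small] := small (c + 3)%N ltac:(lia).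
exists (n1 + n2 + n3 + n4 + 2)%N => n n_large.
case idle : ((adv_rounds (A n) == 0%N) || (csize (adv_step (A n)) == 0%N)).
  rewrite fail_prob_idle // invr_gt0 exprn_gt0 // ltr0n; lia.
have /norP[rounds0 step0] := negbT idle.
pose B := (n.+2 ^ c0)%N.
have gB : (g n <= B)%N := g_le n.
have lamS := S_large n ltac:(lia).
have game_le m ws : size ws = adv_rounds (A n) ->
  E (setup_dist (stream_alg_of P (k n) (S n) (A0 n)))
     (fun h => (game (adv := A n) (k n) (A0 n) m h ws : nat)%:R)
    <= (index_len n).+1%:R * eps (S n).
  move=> sz_ws.
  have time_B : (adv_time (A n) <= B)%N by move: gB; rewrite /g; lia.
  have [mem_B rounds_B coins_B step_B] := adv_time_ge rounds0 step0.
  have ws_B : (size ws <= B)%N by rewrite sz_ws (leq_trans rounds_B).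
  have {}mem_B := leq_trans mem_B time_B.
  have {}coins_B := leq_trans coins_B time_B.
  have {}step_B := leq_trans step_B time_B.
  have K_B : (K (S n) <= B)%N by move: gB; rewrite /g; lia.
  have pk_B : plen B 1 (pk_t F (S n)).
    by rewrite plenE expn1; apply: leq_trans K_B; apply: leq_addr.
  have dim_B : (ctdim F (S n) <= B)%N.
    by apply: leq_trans K_B; apply: leq_trans (ctdim_le _ _) (leq_addl _ _).
  have [blen_upd [C_upd C_upd_le C_updE]] := upd n.
  have [_ [C_rep C_rep_le C_repE]] := rep n.
  have [blen_enc [C_enc C_enc_le C_encE]] := enc (S n).
  have A0_B : (g_A0 n <= B)%N by move: gB; rewrite /g; lia.
  have F_B : (g_F n <= B)%N by move: gB; rewrite /g; lia.
  have st_B : plen B 1 (det_state (A0 n)).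
    rewrite plenE expn1; apply: leq_trans A0_B; apply: leq_trans (leq_addr _ _).
    by apply: leq_trans blen_upd; rewrite blen_pair leq_addr.
  have rnd_B : plen B 1 ((enc_coins F (S n)).-tuple bool).
    rewrite plenE expn1; apply: leq_trans F_B; apply: leq_trans (leq_addr _ _).
    by apply: leq_trans blen_enc; rewrite blen_pair leq_addl.
  have upd_B : eff B 1 (fun a : det_state (A0 n) * upd_t n (N n) => det_update a.1 a.2).
    exists C_upd => //; rewrite expn1; apply: leq_trans C_upd_le (leq_trans _ A0_B).
    exact: leq_addr.
  have rep_B : eff B 1 (fun s : det_state (A0 n) => det_report s).
    exists C_rep => //; rewrite expn1; apply: leq_trans C_rep_le (leq_trans _ A0_B).
    exact: leq_addl.
  have enc_B : eff B 1 (fun a : pk_t F (S n) * bool * (enc_coins F (S n)).-tuple bool =>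
      fhe_enc a.1.1 a.1.2 a.2).
    exists C_enc => //; rewrite expn1; apply: leq_trans C_enc_le (leq_trans _ F_B).
    exact: leq_addr.
  have len_n : (index_len n <= n)%N by apply: up_log_min => //; exact/ltnW/ltn_expl.
  have le_d : ((index_len n).*2.+1 <= d (S n))%N.
    by rewrite /d ltnS leq_double; apply: len_le; lia.
  have ct_B (i : 'I_n) : eff B 1 (fun h : hash_key F n (S n) => index_ct h i).
    have [C C_le CE] := eval (S n) _ _ (point_circuit_wf (index_len n) i)
      (leq_trans (cdepth_point_circuit _ _) le_d).
    exists C => //; rewrite expn1; apply: leq_trans C_le (leq_trans _ F_B).
    apply: leq_trans (leq_addl _ _); rewrite leq_add2r; apply: leq_exp2rW.
    by rewrite /csize /= size_point_gates size_bin; lia.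
  have T_B : (B ^ 200 <= T (S n))%N.
    apply: leq_trans (T_le n ltac:(lia)); rewrite /B -expnM [X in (_ <= X)%N]expnM.
    by apply: leq_exp2rW; rewrite -mulnn; nia.
  have n_B : (2 * n.+2 <= B)%N by move: gB; rewrite /g; lia.
  have N_B : (2 * (N n).*2.*2.+1 <= B)%N by move: gB; rewrite /g; lia.
  have q_B : (2 * modulus F (S n) <= B)%N by move: gB; rewrite /g; lia.
  have B_ge : (16 <= B)%N by move: gB; rewrite /g; lia.
  apply: (ideal_real (b := index_bits m) (t := T (S n))
    (f := fun h => game (adv := A n) (k n) (A0 n) m h ws)).
  - by apply: pk_ind; lia.
  - by case; [apply: ct_indT | apply: ct_indF]; lia.
  - move=> cs; have [C C_le CE] := eff_game_pk (k n) m B_ge n_B N_B q_B dim_B pk_B st_B mem_B coins_B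
      step_B upd_B rep_B ct_B cs ws_B.
    by exists C => //; apply: leq_trans T_B.
  - move=> i rs cs; have [C C_le CE] := eff_game_mix (k n) m B_ge n_B N_B q_B dim_B pk_B st_B mem_B
      coins_B step_B upd_B rep_B ct_B rnd_B enc_B (index_bits m) i rs cs ws_B.
    by exists C => //; apply: leq_trans T_B.
  move=> w rs; apply: game_binding => x x'.
  by apply: binding => //; lia.
have lt_eps : eps (S n) < n%:R ^- (c + 3) by apply: le_lt_trans (le_negl n) (small n _); lia.
apply: le_lt_trans (_ : _ <= \sum_(m < n) (index_len n).+1%:R * eps (S n)) _.
  rewrite /fail_prob -[X in _ <= X](E_coins_const (A n) (adv_rounds (A n))).
  eapply le_trans.
    by apply: E_le => h; exact: (play_start_le P (A n) (@A0_correct n) (adv_rounds (A n)) h).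
  (* The coins of the adversary are drawn before the key, so that [game_le] can hardwire them. *)
  rewrite E_E_coins; apply: E_coins_le => ws sz_ws; rewrite E_sum.
  by apply: ler_sum => m _; apply: game_le.
rewrite sumr_const card_ord -(mulr_natl (_ * _)) mulrA -natrM.
have n_gt0 : 0 < n%:R :> R by rewrite ltr0n; lia.
have len_n : (index_len n <= n)%N by apply: up_log_min => //; exact/ltnW/ltn_expl.
have := lt_eps; rewrite -(ltr_pM2l (x := (n * (index_len n).+1)%:R)); last by rewrite ltr0n; nia.
move/lt_le_trans; apply; rewrite exprD invfM mulrCA -[leRHS]mulr1.
rewrite ler_pM2l ?invr_gt0 ?exprn_gt0 // ler_pdivrMr ?exprn_gt0 // mul1r -natrX ler_nat.
by rewrite !expnS expn0 muln1 leq_mul2l; apply/orP; right; nia.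
Qed.
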